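(* Let $f:(S^2,A)\to(S^2,A)$ be a marked post-critically finite branched covering and let $G\subset S^2$ be a forward invariant graph (i.e. $f(G)\subset G$), possibly disconnected, such that $h_{top}(f|_G)=0$. Then every irreducible Thurston obstruction of $f:(S^2,A)\to(S^2,A)$ that intersects $G$ is a Levy cycle.
   Context: A branched covering $f:S^2\to S^2$ is a continuous map that locally looks like $z\mapsto z^d$, $d\ge1$; $\Omega_f$ is its critical set and $P_f=\bigcup_{k\ge1}f^k(\Omega_f)$. A marked post-critically finite branched covering $f:(S^2,A)\to(S^2,A)$ has $A$ finite, $P_f\subset A$, $f(A)\subset A$. A simple closed curve in $S^2\setminus A$ is essential relative to $A$ if it is neither null-homotopic nor peripheral in $S^2\setminus A$. A multicurve $\Gamma$ is a finite collection of pairwise disjoint, pairwise non-isotopic (relative to $A$) simple closed curves essential relative to $A$. Its Thurston linear transformation $f_\Gamma:\mathbb{R}^\Gamma\to\mathbb{R}^\Gamma$ is $$f_\Gamma(\gamma)=\sum_{\gamma'\subset f^{-1}(\gamma)}\frac{1}{\deg(f|_{\gamma'}:\gamma'\to\gamma)}[\gamma']_\Gamma,$$ summed over components $\gamma'$ of $f^{-1}(\gamma)$ that are isotopic relative to $A$ to some element $[\gamma']_\Gamma$ of $\Gamma$. $\Gamma$ is a Thurston obstruction if the spectral radius of $f_\Gamma$ is at least $1$; it is irreducible if $f_\Gamma$ is an irreducible matrix (for all $i,j$ there is $k\ge1$ with $(f_\Gamma^k)_{ij}>0$). A Levy cycle is a collection $\{\gamma_1,\dots,\gamma_k\}$ of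 simple closed curves essential relative to $A$ such that for each $i$ (indices mod $k$) some component $\gamma_i'$ of $f^{-1}(\gamma_i)$ is isotopic to $\gamma_{i+1}$ relative to $A$ and $f|_{\gamma_i'}:\gamma_i'\to\gamma_i$ is a homeomorphism. $\Gamma$ intersects $G$ if it has nonzero geometric intersection number with $G$, i.e. some curve of $\Gamma$ cannot be isotoped relative to $A$ off $G$. Here $G$ is a finite graph embedded in $S^2$ with vertex set such that $f|_G:G\to G$ is Markov ($f(\mathrm{Vert}(G))\subset\mathrm{Vert}(G)$, and $f$ is a homeomorphism or constant on each component of $G\setminus f^{-1}(\mathrm{Vert}(G))$), and $h_{top}$ is topological entropy, which for a Markov graph map equals $0$ if the spectral radius $\lambda$ of its adjacency matrix ($(i,j)$-entry: number of times $f(e_i)$ covers $e_j$) is $0$, and $\log\lambda$ otherwise. *)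

(* Defs.v *)
From HB Require Import structures.
From mathcomp Require Import all_boot all_order all_algebra.
From mathcomp Require Import perm complex.
From mathcomp Require Import all_classical all_reals all_analysis.

Set Implicit Arguments.
Unset Strict Implicit.
Unset Printing Implicit Defensive.

Import Order.TTheory GRing.Theory Num.Theory.
Import numFieldNormedType.Exports.

Local Open Scope classical_set_scope.
Local Open Scope ring_scope.
Local Open Scope complex_scope.
Local Open Scope card_scope.

(* [sphere R n] coerces to the type of points of S^n, with the subspace
   topology (and pseudometric) inherited from R^(n+1). *)
Definition sphere (R : realType) (n : nat) : set 'rV[R]_n.+1 :=
  [set x : 'rV[R]_n.+1 | \sum_i x ord0 i ^+ 2 = 1].
Arguments sphere : clear implicits.

Notation S1 R := (set_type (sphere R 1)).
Notation S2 R := (set_type (sphere R 2)).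

Section PlaneTopology.
Variable R : realType.
Implicit Types (A B C D : set (S2 R)).

Definition homeo_between (X Y : topologicalType) (C : set X) (D : set Y)
    (f : X -> Y) : Prop :=
  exists g : Y -> X,
    [/\ {within C, continuous f}, {within D, continuous g},
        {homo f : x / C x >-> D x}, {homo g : y / D y >-> C y} &
        (forall x, C x -> g (f x) = x) /\ (forall y, D y -> f (g y) = y)].

Definition is_component (X : topologicalType) (B C : set X) : Prop :=
  exists2 x, B x & C = connected_component B x.

Definition param (C : set (S2 R)) (c : S1 R -> S2 R) : Prop :=
  [/\ continuous c, injective c & range c = C].

Definition simple_closed_curve C : Prop := exists c, param C c.

(* Free homotopy of loops in the complement of A. *)
Definition homotopic_off A (c d : S1 R -> S2 R) : Prop :=
  exists H : R -> S1 R -> S2 R,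
    [/\ {within `[0, 1]%classic `*` setT,
           continuous (fun p : R * S1 R => H p.1 p.2)},
        (forall t x, 0 <= t <= 1 -> ~ A (H t x)),
        H 0 = c & H 1 = d].

Definition null_homotopic A C : Prop :=
  exists2 c, param C c & exists x, homotopic_off A c (fun=> x).

(* Homotopic, in the complement of A, into every neighbourhood of some
   puncture. *)
Definition peripheral A C : Prop :=
  exists2 c, param C c & exists2 a, A a &
    forall U, nbhs a U -> exists2 d, range d `<=` U & homotopic_off A c d.

Definition essential A C : Prop :=
  [/\ simple_closed_curve C, A `&` C = set0,
      ~ null_homotopic A C & ~ peripheral A C].

(* Ambient isotopy of the sphere, fixing A pointwise. *)
Definition isotopic A C D : Prop :=
  exists Phi : R -> S2 R -> S2 R,
    [/\ {within `[0, 1]%classic `*` setT,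
           continuous (fun p : R * S2 R => Phi p.1 p.2)},
        (forall t, 0 <= t <= 1 -> homeo_between setT setT (Phi t)),
        (forall t a, 0 <= t <= 1 -> A a -> Phi t a = a),
        Phi 0 = id & Phi 1 @` C = D].

End PlaneTopology.

Section BranchedCoverings.
Variables (R : realType) (f : S2 R -> S2 R).

(* The regular module [R[i]^o] carries the norm topology of C. *)
Definition unit_disk : set (R[i])^o := [set z | `|z| < 1].

Definition looks_like_power (x : S2 R) (d : nat) : Prop :=
  exists (U V : set (S2 R)) (phi psi : S2 R -> (R[i])^o),
    [/\ [/\ open U, U x, open V & f @` U `<=` V],
        homeo_between U unit_disk phi /\ phi x = 0,
        homeo_between V unit_disk psi /\ psi (f x) = 0 &
        forall y, U y -> psi (f y) = phi y ^+ d].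

Definition branched_covering : Prop :=
  continuous f /\ forall x, exists2 d, (0 < d)%N & looks_like_power x d.

Definition critical_set : set (S2 R) :=
  [set x | exists2 d, (1 < d)%N & looks_like_power x d].

Definition postcritical_set : set (S2 R) :=
  \bigcup_(k in [set k | (0 < k)%N]) (iter k f @` critical_set).

Definition marked_pcf (A : set (S2 R)) : Prop :=
  [/\ branched_covering, finite_set A, postcritical_set `<=` A &
      f @` A `<=` A].

(* Number of sheets of the covering f : C' -> C. *)
Definition cover_degree (C' C : set (S2 R)) : nat :=
  get [set d : nat | forall y, C y -> (C' `&` f @^-1` [set y]) #= `I_d].

End BranchedCoverings.

Section Multicurves.
Variables (R : realType) (f : S2 R -> S2 R) (A : set (S2 R)).

Definition multicurve n (gam : 'I_n -> set (S2 R)) : Prop :=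
  (forall i, essential A (gam i)) /\
  (forall i j, i != j ->
     gam i `&` gam j = set0 /\ ~ isotopic A (gam i) (gam j)).

Definition sheet_weight (C' C : set (S2 R)) : R :=
  (cover_degree f C' C)%:R^-1.

(* Column j holds the coordinates of the image of gam j. *)
Definition thurston_matrix n (gam : 'I_n -> set (S2 R)) : 'M[R]_n :=
  \matrix_(i, j)
    \sum_(C' \in [set C' : set (S2 R) | is_component (f @^-1` gam j) C' /\
                                        isotopic A C' (gam i)])
      sheet_weight C' (gam j).

(* Equal to 0 for the empty matrix, since sup set0 = 0. *)
Definition spectral_radius n (M : 'M[R]_n) : R :=
  sup [set complex.Re `|z| |
        z in [set z : R[i] | eigenvalue (map_mx (real_complex R) M) z]].

Definition irreducible_mx n (M : 'M[R]_n) : Prop :=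
  forall i j, exists2 k, (0 < k)%N & 0 < (M ^+ k) i j.

Definition thurston_obstruction n (gam : 'I_n -> set (S2 R)) : Prop :=
  multicurve gam /\ 1 <= spectral_radius (thurston_matrix gam).

Definition irreducible_multicurve n (gam : 'I_n -> set (S2 R)) : Prop :=
  irreducible_mx (thurston_matrix gam).

(* The permutation s gives the cyclic order gam (s 0), gam (s 1), ... of the
   unordered collection; ordS is the successor mod n. *)
Definition levy_cycle n (gam : 'I_n -> set (S2 R)) : Prop :=
  [/\ (0 < n)%N, (forall i, essential A (gam i)) &
      exists s : 'S_n, forall i, exists C',
        [/\ is_component (f @^-1` gam (s i)) C',
            isotopic A C' (gam (s (ordS i))) &
            homeo_between C' (gam (s i)) f]].

Definition intersects n (gam : 'I_n -> set (S2 R)) (G : set (S2 R)) : Prop :=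
  exists i, forall C, isotopic A (gam i) C -> C `&` G !=set0.

End Multicurves.

Section Graphs.
Variable R : realType.

(* Loops, multiple edges and isolated vertices are allowed. *)
Definition embedded_graph (V G : set (S2 R)) : Prop :=
  finite_set V /\
  exists (m : nat) (e : 'I_m -> R -> S2 R),
    [/\ (forall i, {within `[0, 1]%classic, continuous (e i)}),
        (forall i, V (e i 0) /\ V (e i 1)),
        (forall i s t, 0 < s < 1 -> 0 < t < 1 -> e i s = e i t -> s = t),
        (forall i, e i @` `]0, 1[%classic `&` V = set0) /\
        (forall i j, i != j ->
           e i @` `]0, 1[%classic `&` e j @` `]0, 1[%classic = set0) &
        G = V `|` \bigcup_i (e i @` `[0, 1]%classic)].

Definition markov_graph_map (f : S2 R -> S2 R) (V G : set (S2 R)) : Prop :=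
  f @` V `<=` V /\
  forall I, is_component (G `\` f @^-1` V) I ->
    (exists c, forall x, I x -> f x = c) \/ homeo_between I (f @` I) f.

(* Bowen's definition through (k, eps)-spanning sets. *)
Definition spanning (f : S2 R -> S2 R) (G : set (S2 R)) (k : nat) (eps : R)
    (E : set (S2 R)) : Prop :=
  E `<=` G /\
  forall x, G x -> exists2 y, E y &
    forall j, (j < k)%N -> ball (iter j f x) eps (iter j f y).

Definition h_top (f : S2 R -> S2 R) (G : set (S2 R)) : \bar R :=
  ereal_sup [set limn_esup (fun k : nat =>
      ereal_inf [set (ln N%:R / k%:R)%:E |
        N in [set N : nat | exists2 E, spanning f G k eps E & E #= `I_N]])
    | eps in [set eps : R | 0 < eps]].

End Graphs.

(* Main.v *)
(* Suppose some curve of Gamma has two distinct preimage components isotopic to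
   curves of Gamma. Lifting isotopies and using irreducibility, the level-k
   preimages of a curve gam j then contain exponentially many (along an
   arithmetic progression of k) pairwise disjoint components isotopic to the
   curve that cannot be isotoped off G, so all of them meet G. On the other
   hand, G is cut by f^-1(V) into finitely many points and open arcs forming a
   Markov partition. Two different closed itineraries of equal length would give
   a horseshoe, hence positive entropy, so the number of itineraries of length k
   is polynomial in k. Finally, points of G on level-k preimages of gam j with
   the same itinerary whose images under f^k are close lie on the same
   component: f^k is a covering off A and the images are joined inside a small
   disk both by an arc of G and by an arc of gam j. No transversality between
   Gamma and G is needed. Hence every curve has exactly one preimage component
   isotopic to a curve of Gamma, the Thurston matrix is a weighted cyclic
   permutation, and spectral radius at least 1 forces all weights to be 1. *)
Require Import Defs.
From HB Require Import structures.
From mathcomp Require Import all_boot all_order all_algebra.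
From mathcomp Require Import perm complex.
From mathcomp Require Import all_classical all_reals all_analysis.
From mathcomp Require Import ring lra zify.

Set Implicit Arguments.
Unset Strict Implicit.
Unset Printing Implicit Defensive.

Import Order.TTheory GRing.Theory Num.Theory.
Import numFieldNormedType.Exports.

Local Open Scope classical_set_scope.
Local Open Scope ring_scope.

(** * Paths and uniformity over compact sets *)

(* Paths on [[0, 1]] are represented by total functions [g] on [R] that are
   continuous everywhere and satisfy [g (clamp t) = g t]. *)
Section Clamp.
Variable R : realType.

(** Components are counted, not isotopy classes: the many descendants of a curve lie in a single
    class, yet they are disjoint sets, and disjointness is what lets a point of [G] single out its
    component. Isotopies are therefore lifted as maps of the whole sphere, so that one homeomorphism
    transports all preimage components at once and keeps distinct ones distinct. A horseshoe needs
    two sets at positive distance. Disjoint subarcs of an edge may share an end point, and an edge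
    may close up to a loop, so disjointness alone gives no gap; replacing two return words by the
    eight threefold products of them leaves room for one. To compare two points with the same
    itinerary, the arc of the curve is lifted by the covering property off [A], whereas the arc of
    [G] is pulled back by inverse branches of [f] on the pieces, which makes its end follow the
    orbit of the second point; the homotopy forces the two ends to agree. Since [G] may meet a curve
    in infinitely many points, a finite grid of parameters on edges and curve replaces the list of
    intersection points. *)

Definition clamp (t : R) : R := if t <= 0 then 0 else if 1 <= t then 1 else t.

Lemma clamp_itv t : 0 <= clamp t <= 1.
Proof. by rewrite /clamp; case: (lerP t 0) => ?; case: (lerP 1 t) => ?; lra. Qed.

Lemma clamp_id t : 0 <= t <= 1 -> clamp t = t.
Proof.
by rewrite /clamp => /andP[? ?]; case: (lerP t 0) => ?; case: (lerP 1 t) => ?; lra.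
Qed.

Lemma clampK t : clamp (clamp t) = clamp t.
Proof. exact/clamp_id/clamp_itv. Qed.

Lemma clamp0 : clamp 0 = 0.
Proof. by rewrite clamp_id // lexx ler01. Qed.

Lemma clamp1 : clamp 1 = 1.
Proof. by rewrite clamp_id // lexx ler01. Qed.

Lemma clamp_dist s t : `|clamp s - clamp t| <= `|s - t|.
Proof.
have h1 := ler_norm (s - t); have h2 := ler_norm (t - s).
rewrite distrC in h2; have h3 := normr_ge0 (s - t); rewrite ler_norml /clamp.
by case: (lerP s 0) => ?; case: (lerP t 0) => ?; case: (lerP 1 s) => ?;
  case: (lerP 1 t) => ?; apply/andP; split; lra.
Qed.

Lemma continuous_clamp : continuous clamp.
Proof.
move=> t; apply/cvgrPdist_lt => e e0; near=> s.
apply: le_lt_trans (clamp_dist _ _) _.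
near: s; exact: cvgr_dist_lt.
Unshelve. all: end_near. Qed.

(** Uniqueness, stability and trapping of lifts are all proved by clopen arguments on the whole
    line, which is one reason to extend paths to total functions. *)
Lemma clopen_real (S : set R) t : S t -> open S -> closed S -> forall s, S s.
Proof.
move=> St oS cS s.
have cT : connected [set: R] by apply/connected_intervalP.
suff -> : S = setT by [].
by apply: cT; [exists t | exists S => //; rewrite setTI | exists S => //; rewrite setTI].
Qed.

Lemma compact01 : compact (`[0, 1]%classic : set R).
Proof. exact: segment_compact. Qed.

End Clamp.

Lemma continuous_pair (Z T U : topologicalType) (g : Z -> T) (h : Z -> U) z :
  {for z, continuous g} -> {for z, continuous h} ->
  {for z, continuous (fun z => (g z, h z))}.
Proof.
by move=> cg ch; apply: (@cvg_pair _ _ _ (nbhs z) (nbhs (g z)) (nbhs (h z))).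
Qed.

Lemma continuous_pairl (T U : topologicalType) (u : U) : continuous (fun t : T => (t, u)).
Proof. by move=> t; apply: continuous_pair => [U'|]; [exact|exact: cvg_cst]. Qed.

Lemma continuous_pairr (T U : topologicalType) (t : T) : continuous (fun u : U => (t, u)).
Proof.
move=> u; apply: (@continuous_pair _ _ _ (fun=> t) id); first exact: cvg_cst.
exact: cvg_id.
Qed.

Section CompactMetric.
Variables (R : realType) (X : pseudoMetricType R).

(** Lebesgue number argument in filter form: what holds near each point of [K] at all small scales
    holds on [K] at one common scale. Most uniform constants below come from it. *)
Lemma compact_uniform (K : set X) (P : R -> X -> Prop) : compact K ->
  (forall x, K x -> exists2 d : R, 0 < d &
     forall x' r, ball x d x' -> 0 < r < d -> P r x') ->
  exists2 r : R, 0 < r & forall x, K x -> P r x.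
Proof.
move=> /compact_near_coveringP cov H.
have : \forall r \near (0^'+ : set_system R), K `<=` P r.
  apply: cov => x /H[d d0 Hd].
  exists (ball x d, [set r : R | 0 < r < d]) => /=; last first.
    by move=> [x' r] /= [xx' r0d]; exact: Hd.
  split; first exact: nbhsx_ballx.
  near=> r => /=; apply/andP; split; near: r; first exact: nbhs_right_gt.
  exact: nbhs_right_lt.
move=> [r /= r0 rP]; exists (r / 2); first by rewrite divr_gt0.
apply: rP => /=; last by rewrite divr_gt0.
by rewrite sub0r normrN gtr0_norm ?divr_gt0 // ltr_pdivrMr // ltr_pMr //; lra.
Unshelve. all: end_near. Qed.

End CompactMetric.

Section Paths.
Variables (R : realType) (X : pseudoMetricType R).

Lemma path_unif (g : R -> X) (e : R) : continuous g ->
    (forall t, g (clamp t) = g t) -> 0 < e ->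
  exists2 d : R, 0 < d & forall s t, `|s - t| < d -> ball (g s) e (g t).
Proof.
move=> cg gc e0.
have e20 : 0 < e / 2 by rewrite divr_gt0.
have [s _|d d0 dP] := @compact_uniform R R _
    (fun d s => forall t, `|s - t| < d -> ball (g s) e (g t)) (@compact01 R).
  have /cvg_ballP/(_ _ e20)/nbhs_ballP[d /= d0 dP] := cg s.
  exists (d / 2); first by rewrite divr_gt0.
  move=> u r su /andP[r0 rd] t ut; apply: (@ball_splitr _ _ (g s)).
    by apply: dP; apply: le_ball su; lra.
  apply: dP; apply: (@ball_split _ _ u) => //.
  by rewrite -ball_normE /=; apply: lt_trans rd.
exists d => // s t st; rewrite -(gc s) -(gc t); apply: dP.
  by rewrite /= in_itv /= clamp_itv.
exact: le_lt_trans (clamp_dist _ _) st.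
Qed.

Lemma glue_continuous (g h : R -> X) (T : R) :
  continuous g -> continuous h -> g T = h T ->
  continuous (fun t => if t <= T then g t else h t).
Proof.
move=> cg ch gh t; apply/cvg_ballP => e e0.
have /cvg_ballP/(_ _ e0) Hg := cg t; have /cvg_ballP/(_ _ e0) Hh := ch t.
case: (ltrgtP t T) => tT.
- near=> s; have -> : s <= T by apply/ltW; near: s; exact: lt_nbhsl.
  by near: s.
- near=> s; have /negbTE -> : ~~ (s <= T) by rewrite -ltNge; near: s; exact: lt_nbhsr.
  by near: s.
- rewrite tT in Hg Hh *; near=> s; case: ifP => _; first by near: s.
  by rewrite gh; near: s.
Unshelve. all: end_near. Qed.

End Paths.

(** Tube lemma: compactness of the time interval makes closeness uniform in time, and the clamping
    hypothesis takes care of times outside [0, 1]. *)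
Lemma near_uniform_param (R : realType) (X : pseudoMetricType R) (Y : topologicalType)
    (H : R -> Y -> X) (y : Y) (d : R) :
  (forall t, (fun q : R * Y => H q.1 q.2) @ (t, y) --> H t y) ->
  (\forall y' \near y, forall t, H (clamp t) y' = H t y') -> 0 < d ->
  \forall y' \near y, forall s, ball (H s y) d (H s y').
Proof.
move=> cH Hc d0; have d20 : 0 < d / 2 by rewrite divr_gt0.
have /compact_near_coveringP cov := @compact01 R.
have : \forall y' \near y, `[0, 1]%classic `<=` (fun s => ball (H s y) d (H s y')).
  apply: cov => s _; have /cvg_ballP/(_ _ d20) := cH s.
  case=> -[P Q] /= [nP nQ] PQ.
  exists (P, Q) => // -[s' y'] /= [Ps' Qy'].
  apply: (@ball_splitr _ _ (H s y)); last exact: (PQ (s', y')).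
  by apply: (PQ (s', y)); split => //; exact: nbhs_singleton.
have Hcy := nbhs_singleton Hc.
apply: filterS2 Hc => y' Hc' H1 s; rewrite -Hcy -Hc'.
by apply: H1; rewrite /= in_itv /= clamp_itv.
Qed.

(** * Lifting through a proper local homeomorphism *)

Section Lifting.
Variables (R : realType) (X : pseudoMetricType R) (f : X -> X) (A : set X).
Hypothesis hX : hausdorff_space X.
Hypothesis cX : compact [set: X].
Hypothesis cf : continuous f.

(** For continuous [f] this says that [f] maps [U] homeomorphically onto [V] with inverse [s].
    Evenly covered neighbourhoods are never formed; compactness gives the sections a uniform size
    instead. *)
Definition local_section (z : X) := exists (U V : set X) (s : X -> X),
  [/\ open U /\ U z, open V, forall u, U u -> V (f u) /\ s (f u) = u &
      forall v, V v -> [/\ U (s v), f (s v) = v & {for v, continuous s}]].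

Hypothesis loc : forall z, ~ A (f z) -> local_section z.

Lemma lift_unique (g h : R -> X) t0 : continuous g -> continuous h ->
  (forall t, f (g t) = f (h t)) -> (forall t, ~ A (f (g t))) ->
  g t0 = h t0 -> forall t, g t = h t.
Proof.
move=> cg ch fgh nA e0.
apply: (@clopen_real R [set t | g t = h t] t0) => //.
- rewrite openE => t /= gt.
  have [U [V [s [[oU Uz] oV Us _]]]] := loc (nA t).
  have nU : nbhs (g t) U by apply: open_nbhs_nbhs.
  rewrite /interior; near=> t' => /=.
  have Ug : U (g t') by near: t'; exact: cg.
  have Uh : U (h t') by near: t'; apply: ch; rewrite -gt.
  by rewrite -(Us _ Ug).2 -(Us _ Uh).2 fgh.
- rewrite -openC openE => t /= gt.
  move: hX; rewrite open_hausdorff => /(_ (g t) (h t)) [].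
    by apply/eqP.
  move=> [P Q] /= [/set_mem Pg /set_mem Qh] [oP oQ PQ].
  rewrite /interior; near=> t' => /= e.
  have : (P `&` Q) (g t').
    split; first by near: t'; apply: cg; apply: open_nbhs_nbhs.
    by rewrite e; near: t'; apply: ch; apply: open_nbhs_nbhs.
  by move/eqP : PQ => ->.
Unshelve. all: end_near. Qed.

Section CompactSet.
Variable K : set X.
Hypothesis cK : compact K.
Hypothesis KA : forall z, K z -> ~ A (f z).

Lemma uniform_inj : exists2 r : R, 0 < r &
  forall z u v, K z -> ball z r u -> ball z r v -> f u = f v -> u = v.
Proof.
suff [r r0 rP] : exists2 r : R, 0 < r & forall z, K z -> forall u v, ball z r u ->
    ball z r v -> f u = f v -> u = v by exists r => // z u v /rP; exact.
apply: compact_uniform => // z Kz; have [U [V [s [[oU Uz] oV Us _]]]] := loc (KA Kz).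
have /nbhs_ballP[d /= d0 dP] : nbhs z U by apply: open_nbhs_nbhs.
exists (d / 2); first by rewrite divr_gt0.
move=> z' r zz' /andP[r0 rd] u v zu zv fuv.
have Uu : U u.
  by apply: dP; apply: (@ball_split _ _ z') => //; apply: le_ball zu; exact: ltW.
have Uv : U v.
  by apply: dP; apply: (@ball_split _ _ z') => //; apply: le_ball zv; exact: ltW.
by rewrite -(Us _ Uu).2 -(Us _ Uv).2 fuv.
Qed.

Lemma uniform_section (e : R) : 0 < e -> exists2 d : R, 0 < d &
  forall z, K z -> exists2 s : X -> X, s (f z) = z &
    forall w, ball (f z) d w -> [/\ {for w, continuous s}, f (s w) = w & ball z e (s w)].
Proof.
move=> e0; apply: compact_uniform => // z Kz.
have [U [V [s [[oU Uz] oV Us Vs]]]] := loc (KA Kz).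
have [Vfz sfz] := Us _ Uz.
have e20 : 0 < e / 2 by rewrite divr_gt0.
have cs : {for f z, continuous s} by have [] := Vs _ Vfz.
have /nbhs_ballP[d /= d0 dP] : \forall w \near f z, V w /\ ball z (e / 2) (s w).
  apply: filter_app (_ : nbhs (f z) V); last by apply: open_nbhs_nbhs.
  by move/cvg_ballP : cs => /(_ _ e20); rewrite sfz; apply: filterS => w ? ?.
have d20 : 0 < d / 2 by rewrite divr_gt0.
have /nbhs_ballP[h /= h0 hP] : \forall z' \near z,
    [/\ U z', ball z (e / 2) z' & ball (f z) (d / 2) (f z')].
  near=> z'; split; near: z'.
  - exact: open_nbhs_nbhs.
  - exact: nbhsx_ballx.
  - by have /cvg_ballP/(_ _ d20) := @cf z.
exists (Num.min h (d / 2)); first by rewrite lt_min h0.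
move=> z' r zz' /andP[r0]; rewrite lt_min => /andP[_ rd].
have [|Uz' ze' fz'] := hP z'; first by apply: le_ball zz'; rewrite ge_min lexx.
exists s; first by have [] := Us _ Uz'.
move=> w zw; have [|Vw sw] := dP w.
  by apply: (@ball_split _ _ (f z')) => //; apply: le_ball zw; exact: ltW.
have [? ? ?] := Vs _ Vw; split => //; exact: (@ball_splitr _ _ z).
Unshelve. all: end_near. Qed.

End CompactSet.

Lemma compact_path (g : R -> X) : continuous g -> (forall t, g (clamp t) = g t) ->
  compact (range g).
Proof.
move=> cg gc.
have -> : range g = g @` `[0, 1]%classic.
  apply/seteqP; split=> x [t _ <-]; last by exists t.
  by exists (clamp t); rewrite ?gc //= in_itv /= clamp_itv.
apply: continuous_compact; last exact: compact01.
exact: continuous_subspaceT.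
Qed.

Lemma compact_preimage (K : set X) : compact K -> compact (f @^-1` K).
Proof.
move=> cK; apply: (subclosed_compact _ cX) => //.
apply: closed_comp; first by move=> x _; exact: cf.
exact: compact_closed.
Qed.

(** The preimage of the range of [p] is compact, so sections through all its points live on balls of
    one radius. A lift can then be prolonged by a fixed time [h] from any point it has reached, and
    finitely many prolongations suffice. *)
Lemma lift_exists (p : R -> X) x : continuous p -> (forall t, p (clamp t) = p t) ->
  (forall t, ~ A (p t)) -> f x = p 0 ->
  exists g : R -> X, [/\ continuous g, forall t, g (clamp t) = g t, g 0 = x &
    forall t, f (g t) = p t].
Proof.
move=> cp pc pA fx.
have cK : compact (f @^-1` range p) by apply/compact_preimage/compact_path.
have KA z : (f @^-1` range p) z -> ~ A (f z) by move=> [t _ <-].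
have [e e0 He] := uniform_section cK KA (@ltr01 R).
have [d d0 Hd] := path_unif cp pc e0.
pose h := d / 2; have h0 : 0 < h by rewrite divr_gt0.
suff H n : exists g : R -> X, [/\ continuous g, g 0 = x &
    forall t, 0 <= t <= n%:R * h -> f (g t) = p t].
  have [n hn] : exists n : nat, 1 <= n%:R * h.
    exists (Num.bound h^-1); rewrite -ler_pdivrMr // mul1r; apply/ltW.
    by rewrite archi_boundP // invr_ge0 ltW.
  have [g [cg g0 gp]] := H n.
  exists (g \o @clamp R); split => /=.
  - by move=> t; apply: continuous_comp; [exact: continuous_clamp|exact: cg].
  - by move=> t; rewrite clampK.
  - by rewrite clamp0.
  - move=> t; rewrite gp ?pc //; have /andP[-> ?] := clamp_itv t.
    exact: le_trans hn.
elim: n => [|n [g [cg g0 gp]]].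
  exists (fun=> x); split => //; first by move=> t; exact: cvg_cst.
  by move=> t; rewrite mul0r => t0; have -> : t = 0 by lra.
pose T := n%:R * h; have T0 : 0 <= T by rewrite mulr_ge0 // ltW.
have KT : (f @^-1` range p) (g T) by exists T => //; rewrite gp // T0 lexx.
have [s sz Hs] := He _ KT.
have fT : f (g T) = p T by rewrite gp // T0 lexx.
rewrite fT in sz Hs.
(* [k] is the identity on [T, T + h] and constant outside, so [p (k t)] stays in the domain of the
   section for every real [t] and the glued function is continuous everywhere. *)
pose k t := T + h * clamp ((t - T) / h).
have kT : k T = T by rewrite /k subrr mul0r clamp0 mulr0 addr0.
have kd t : `|T - k t| < d.
  rewrite /k opprD addrA subrr sub0r normrN normrM gtr0_norm //.
  have /andP[c0 c1] := clamp_itv ((t - T) / h).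
  rewrite ger0_norm // (@le_lt_trans _ _ h) //; first by rewrite ler_piMr // ltW.
  by rewrite /h ltr_pdivrMr // ltr_pMr //; lra.
have ck : continuous k.
  move=> t; apply: cvgD; first exact: cvg_cst.
  apply: cvgM; first exact: cvg_cst.
  apply: (@continuous_comp _ _ _ (fun t => (t - T) / h)); last exact: continuous_clamp.
  by apply: cvgM; [apply: cvgB; [exact: cvg_id|exact: cvg_cst]|exact: cvg_cst].
exists (fun t => if t <= T then g t else s (p (k t))); split.
- apply: glue_continuous => //; last by rewrite kT.
  move=> t; have [cs _ _] := Hs _ (Hd _ _ (kd t)).
  apply: (@continuous_comp _ _ _ (p \o k)) => //.
  by apply: continuous_comp; [exact: ck|exact: cp].
- by rewrite T0.
- move=> t /andP[t0 tn]; case: (lerP t T) => tT; first by rewrite gp // t0.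
  have [_ -> _] := Hs _ (Hd _ _ (kd t)).
  suff tT' : 0 <= (t - T) / h <= 1.
    by rewrite /k clamp_id // mulrC divfK ?gt_eqF // addrC subrK.
  rewrite divr_ge0 ?subr_ge0 ?(ltW tT) ?(ltW h0) //= ler_pdivrMr // mul1r lerBlDr.
  by apply: le_trans tn _; rewrite /T -natr1 mulrDl mul1r addrC.
Qed.

Lemma lift_stable (g : R -> X) (e : R) : continuous g -> (forall t, g (clamp t) = g t) ->
  (forall t, ~ A (f (g t))) -> 0 < e -> exists2 d : R, 0 < d &
  forall h : R -> X, continuous h -> ball (g 0) d (h 0) ->
    (forall t, ball (f (g t)) d (f (h t))) -> forall t, ball (g t) e (h t).
Proof.
move=> cg gc gA e0.
have cK := compact_path cg gc.
have KA z : range g z -> ~ A (f z) by move=> [t _ <-].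
have [r r0 inj] := uniform_inj cK KA.
(* The bound [r / 3] leaves room for two continuity errors of [r / 3] in the proof of closedness. *)
pose e1 := Num.min e (r / 3).
have e10 : 0 < e1 by rewrite lt_min e0 divr_gt0.
have e1e : e1 <= e by rewrite ge_min lexx.
have e1r : e1 <= r / 3 by rewrite ge_min lexx orbT.
have e120 : 0 < e1 / 2 by rewrite divr_gt0.
have [d d0 Hd] := uniform_section cK KA e120.
exists (Num.min d e1); first by rewrite lt_min d0.
move=> h ch h0 fh t; apply: (le_ball e1e).
(* Self-improving estimate: within distance [r], injectivity identifies [h s] with the value of the
   section, which is within [e1 / 2]. This makes closeness up to [e1] both an open and a closed
   condition on time. *)
have key s : ball (g s) r (h s) -> ball (g s) (e1 / 2) (h s).
  move=> gh; have [] := Hd (g s); first by exists s.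
  move=> sg sgE /(_ (f (h s))) [].
    by apply: le_ball (fh s); rewrite ge_min lexx.
  move=> _ fs gs; have <- // : sg (f (h s)) = h s.
  apply: (inj (g s)) fs => //; apply: le_ball gs; lra.
apply: (@clopen_real R [set s | ball (g s) e1 (h s)] 0) => /=.
- by apply: le_ball h0; rewrite ge_min lexx orbT.
- rewrite openE => s /= gh.
  have gh2 : ball (g s) (e1 / 2) (h s) by apply: key; apply: le_ball gh; lra.
  have e40 : 0 < e1 / 2 / 2 by rewrite divr_gt0.
  have /cvg_ballP/(_ _ e40) ng := cg s.
  have /cvg_ballP/(_ _ e40) nh := ch s.
  rewrite /interior; near=> s' => /=.
  have -> : e1 = e1 / 2 / 2 + (e1 / 2 + e1 / 2 / 2) by field.
  apply: (@ball_triangle _ _ (g s)); first by apply: ball_sym; near: s'.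
  by apply: (@ball_triangle _ _ (h s)) => //; near: s'.
- move=> s Ss.
  have r30 : 0 < r / 3 by rewrite divr_gt0.
  have /cvg_ballP/(_ _ r30) ng := cg s.
  have /cvg_ballP/(_ _ r30) nh := ch s.
  have [s' [/= gs' [s1 s2]]] := Ss _ (filterI ng nh).
  apply: (@le_ball _ _ _ (e1 / 2)); first by lra.
  apply: key; have -> : r = r / 3 + (r / 3 + r / 3) by field.
  apply: (@ball_triangle _ _ (g s')) => //.
  apply: (@ball_triangle _ _ (h s')) => //; last exact: ball_sym.
  exact: le_ball gs'.
Unshelve. all: end_near. Qed.

(** Each track is lifted separately, with no coherence between the choices. Joint continuity follows
    afterwards, because [lift_stable] gives uniformly close tracks close lifts. *)
Lemma homotopy_lift (Y : topologicalType) (H : R -> Y -> X) (D : set Y) (h0 : Y -> X) :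
  (forall y t, D y -> [/\ (fun q : R * Y => H q.1 q.2) @ (t, y) --> H t y,
                         H (clamp t) y = H t y & ~ A (H t y)]) ->
  (forall y, D y -> f (h0 y) = H 0 y) -> open D ->
  (forall y, D y -> {for y, continuous h0}) ->
  exists L : R -> Y -> X, forall y, D y ->
    [/\ L 0 y = h0 y, forall t, L (clamp t) y = L t y, forall t, f (L t y) = H t y &
        forall t, (fun q : R * Y => L q.1 q.2) @ (t, y) --> L t y].
Proof.
move=> HH h0H oD ch0.
have cHy y : D y -> continuous (H^~ y).
  move=> Dy t; have [cH _ _] := HH y t Dy.
  apply: (@continuous_comp R _ X (fun t => (t, y)) (fun q => H q.1 q.2)) => //=.
  exact: continuous_pairl.
have /choice[L0 HL0] : forall y, exists g : R -> X, D y ->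
    [/\ continuous g, forall t, g (clamp t) = g t, g 0 = h0 y & forall t, f (g t) = H t y].
  move=> y; have [Dy|nD] := pselect (D y); last by exists (fun=> h0 y).
  have [||||g ?] := @lift_exists (H^~ y) (h0 y).
  - exact: cHy.
  - by move=> t; have [] := HH y t Dy.
  - by move=> t; have [] := HH y t Dy.
  - exact: h0H.
  - by exists g.
exists (fun t y => L0 y t) => y Dy.
have [cL Lc L0y fL] := HL0 y Dy; split => // t.
apply/cvg_ballP => e e0 /=.
have e20 : 0 < e / 2 by rewrite divr_gt0.
have nA s : ~ A (f (L0 y s)) by rewrite fL; have [] := HH y s Dy.
have [d d0 Hd] := lift_stable cL Lc nA e20.
have ny : \forall y' \near y, forall s, ball (H s y) d (H s y').
  apply: near_uniform_param d0 => [s|]; first by have [] := HH y s Dy.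
  apply: filterS (open_nbhs_nbhs (conj oD Dy)) => y' Dy' s.
  by have [] := HH y' s Dy'.
have nh : \forall y' \near y, ball (h0 y) d (h0 y').
  by have /cvg_ballP/(_ _ d0) := ch0 _ Dy.
have nD : nbhs y D by apply: open_nbhs_nbhs.
have nt : \forall t' \near t, ball (L0 y t) (e / 2) (L0 y t').
  by have /cvg_ballP/(_ _ e20) := cL t.
near=> q => /=.
have Dq : D q.2 by near: q; exact: (@cvg_snd _ _ (nbhs t) (nbhs y) _ _ nD).
have [cLq _ L0q fLq] := HL0 _ Dq.
apply: (@ball_split _ _ (L0 y q.1)).
  by near: q; exact: (@cvg_fst _ _ (nbhs t) (nbhs y) _ _ nt).
apply: Hd => //.
  by rewrite L0y L0q; near: q; exact: (@cvg_snd _ _ (nbhs t) (nbhs y) _ _ nh).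
move=> s; rewrite fL fLq; move: s; near: q.
exact: (@cvg_snd _ _ (nbhs t) (nbhs y) _ _ ny).
Unshelve. all: end_near. Qed.

End Lifting.

(** * Lifting ambient isotopies through a branched covering *)

Section IsotopyLifting.
Variables (R : realType) (X : pseudoMetricType R) (f : X -> X) (A : set X).
Hypothesis hX : hausdorff_space X.
Hypothesis cX : compact [set: X].
Hypothesis cf : continuous f.
Hypothesis loc : forall z, ~ A (f z) -> local_section f z.
Hypothesis clA : closed A.
Hypothesis isol : forall b, A (f b) ->
  \forall x \near b, f x = f b -> x = b.

(** Only a bijection is required at each time: on a compact Hausdorff space the inverse is
    automatically continuous. *)
Record is_isotopy (B : set X) (Phi : R -> X -> X) : Prop := IsIsotopy {
  isotopy_continuous : continuous (fun q : R * X => Phi q.1 q.2);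
  isotopy_clamp : forall t, Phi (clamp t) = Phi t;
  isotopy_inj : forall t, injective (Phi t);
  isotopy_surj : forall t y, exists x, Phi t x = y;
  isotopy_rel : forall t b, B b -> Phi t b = b;
  isotopy0 : forall x, Phi 0 x = x }.

Lemma isotopy_path B Phi x : is_isotopy B Phi -> continuous (Phi^~ x).
Proof.
move=> iP t; apply: (@continuous_comp R _ X (fun t => (t, x)) (fun q => Phi q.1 q.2)).
  exact: continuous_pairl.
exact: (isotopy_continuous iP).
Qed.

(* Near [b] a lift cannot cross the boundary of a small neighbourhood of [b]:
   [f] maps that boundary away from [f b], while [Phi] keeps points close to [f b]
   close to it. *)
Lemma trapped_near (Phi : R -> X -> X) b e : is_isotopy A Phi -> A (f b) -> 0 < e ->
  \forall x \near b, forall g : R -> X, continuous g -> g 0 = x ->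
    (forall t, f (g t) = Phi t (f x)) -> forall t, ball b e (g t).
Proof.
move=> iP Afb e0.
have /nbhs_ballP[d /= d0 dP] := isol Afb.
pose r := Num.min e (d / 2).
have r0 : 0 < r by rewrite lt_min e0 divr_gt0.
have [re rd] : r <= e /\ r <= d / 2 by rewrite !ge_min !lexx orbT.
pose W := (ball b r)°.
have oW : open W by exact: open_interior.
have Wb : W b by apply: nbhsx_ballx.
pose K := closure W `&` ~` W.
have cK : compact K.
  apply: (subclosed_compact _ cX) => //; apply: closedI; first exact: closed_closure.
  exact: open_closedC.
have Kfb : ~ (f @` K) (f b).
  move=> [z [cz nWz] fz]; apply: nWz; have -> // : z = b.
  apply: dP fz => /=.
  have d20 : 0 < d / 2 by rewrite divr_gt0.
  have [w [/interior_subset bw zw]] := cz _ (nbhsx_ballx z _ d20).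
  apply: (@ball_splitl _ _ w) => //; exact: le_ball bw.
have cfK : closed (f @` K).
  apply: compact_closed => //; apply: continuous_compact => //.
  exact: continuous_subspaceT.
have /nbhs_ballP[h /= h0 hP] : nbhs (f b) (~` (f @` K)).
  by apply: open_nbhs_nbhs; split => //; rewrite openC.
have /nbhs_ballP[k /= k0 kP] :
    \forall y \near f b, forall s, ball (Phi s (f b)) h (Phi s y).
  apply: (@near_uniform_param R X X Phi (f b) h _ _ h0) => [t|].
    by have cP := isotopy_continuous iP; exact: (cP (t, f b)).
  by near=> y => t; rewrite (isotopy_clamp iP).
near=> x => g cg g0 fg t.
have Wx : W x by near: x; exact: open_nbhs_nbhs.
have nK s : ~ K (g s).
  move=> Kg; apply: (hP (f (g s))); last by exists (g s).
  rewrite fg -[X in ball X _ _](isotopy_rel iP s Afb); apply: kP.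
  by near: x; have /cvg_ballP/(_ _ k0) := @cf b.
apply: (le_ball re); apply: interior_subset.
apply: (@clopen_real R (g @^-1` W) 0); first by rewrite /= g0.
- by apply: open_comp => // s _; exact: cg.
- move=> s Ss; apply: contrapT => nW; apply: (nK s); split => //.
  move=> N nN; have /Ss [s' [/= ? ?]] := cg s _ nN.
  by exists (g s').
Unshelve. all: end_near. Qed.

Theorem isotopy_lift (Phi : R -> X -> X) : is_isotopy A Phi ->
  exists2 Psi, is_isotopy (f @^-1` A) Psi & forall t x, f (Psi t x) = Phi t (f x).
Proof.
move=> iP.
pose D := ~` (f @^-1` A).
have oD : open D.
  by rewrite openC; apply: closed_comp => // x _; exact: cf.
have nA t x : D x -> ~ A (Phi t (f x)).
  move=> Dx AP; apply: Dx => /=.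
  by rewrite -[f x](isotopy_inj iP (isotopy_rel iP t AP)).
have cH : continuous (fun q : R * X => Phi q.1 (f q.2)).
  move=> q; apply: (@continuous_comp _ _ _ (fun q : R * X => (q.1, f q.2)) (fun q => Phi q.1 q.2)).
    apply: continuous_pair; first exact: cvg_fst.
    apply: (@continuous_comp _ _ _ snd f); first exact: cvg_snd.
    exact: cf.
  exact: (isotopy_continuous iP).
have := @homotopy_lift R X f A hX cX cf loc X (fun t x => Phi t (f x)) D id.
case.
- move=> x t Dx; split; [exact: (cH (t, x))|by rewrite (isotopy_clamp iP)|exact: nA].
- by move=> x _; rewrite (isotopy0 iP).
- exact: oD.
- by move=> x _; exact: cvg_id.
move=> L HL.
pose Psi t x := if `[< A (f x) >] then x else L t x.
have PB t x : A (f x) -> Psi t x = x by rewrite /Psi => ?; rewrite asboolT.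
have PD t x : D x -> Psi t x = L t x by rewrite /Psi => ?; rewrite asboolF.
have fP t x : f (Psi t x) = Phi t (f x).
  have [Ax|Dx] := pselect (A (f x)).
    by rewrite PB // (isotopy_rel iP).
  by rewrite PD //; have [_ _ ->] := HL x Dx.
have cP x : continuous (Psi^~ x).
  have [Ax|Dx] := pselect (A (f x)).
    have -> : Psi^~ x = fun=> x by apply/funext => t; rewrite PB.
    by move=> ?; exact: cvg_cst.
  have -> : Psi^~ x = L^~ x by apply/funext => t; rewrite PD.
  have [_ _ _ cL] := HL x Dx => t.
  apply: (@continuous_comp R _ X (fun t => (t, x)) (fun q => L q.1 q.2)).
    exact: continuous_pairl.
  exact: cL.
have P0 x : Psi 0 x = x.
  have [Ax|Dx] := pselect (A (f x)); first by rewrite PB.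
  by rewrite PD //; have [-> ] := HL x Dx.
have Pc t x : Psi (clamp t) x = Psi t x.
  have [Ax|Dx] := pselect (A (f x)); first by rewrite !PB.
  by rewrite !PD //; have [_ -> ] := HL x Dx.
exists Psi => //; split => //.
- move=> [t x]; have [Ax|Dx] := pselect (A (f x)).
    apply/cvg_ballP => e e0 /=; rewrite PB //.
    have ny : \forall y \near x, forall s, ball x e (Psi s y).
      have := trapped_near iP Ax e0; apply: filterS => y H.
      by apply: H => [||s]; [exact: cP|exact: P0|exact: fP].
    near=> q; move: q.1; near: q; exact: (@cvg_snd _ _ (nbhs t) (nbhs x) _ _ ny).
  have [_ _ _ /(_ t) cL] := HL x Dx.
  rewrite /continuous_at /= PD //; apply: cvg_trans cL; apply: near_eq_cvg.
  near=> q; rewrite PD //; near: q.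
  by apply: (@cvg_snd _ _ (nbhs t) (nbhs x) _ D); exact: open_nbhs_nbhs.
- by move=> t; apply/funext => x.
- move=> t x x' e.
  have [Ax|Dx] := pselect (A (f x)); have [Ax'|Dx'] := pselect (A (f x')).
  + by rewrite -(PB t x) // -(PB t x').
  + exfalso; apply: (nA t _ Dx'); rewrite -fP -e PB //.
  + exfalso; apply: (nA t _ Dx); rewrite -fP e PB //.
  + have fx : f x = f x' by apply: (isotopy_inj iP (t := t)); rewrite -!fP e.
    rewrite -(P0 x) -(P0 x').
    apply: (lift_unique hX loc (cP x) (cP x') _ _ e) => s; rewrite !fP ?fx //.
    exact: nA.
- move=> t w; have [Aw|Dw] := pselect (A (f w)); first by exists w; rewrite PB.
  have [y yw] := isotopy_surj iP t (f w).
  have nAy s : ~ A (Phi s y).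
    move=> AP; have y1 : y = Phi s y.
      by apply: (isotopy_inj iP (t := s)); rewrite (isotopy_rel iP s AP).
    by apply: Dw => /=; rewrite -yw (isotopy_rel iP) // y1.
  (* Surjectivity by reversing time: the reversed track of [y] is lifted from [w], and its end [g 1]
     has a forward track that runs back along the same lift and reaches [w] at time [t]. *)
  pose k u := clamp t * (1 - clamp u).
  have ck : continuous k.
    move=> u; apply: cvgM; first exact: cvg_cst.
    by apply: cvgB; [exact: cvg_cst|exact: continuous_clamp].
  have [||||g [cg gc g0 gp]] := @lift_exists R X f A hX cX cf loc (fun u => Phi (k u) y) w.
  + move=> u; apply: (@continuous_comp _ _ _ k (Phi^~ y)); first exact: ck.
    exact: isotopy_path iP _.
  + by move=> u; rewrite /k clampK.
  + by move=> u; exact: nAy.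
  + by rewrite /k clamp0 subr0 mulr1 (isotopy_clamp iP).
  exists (g 1).
  have fg1 : f (g 1) = y by rewrite gp /k clamp1 subrr mulr0 (isotopy0 iP).
  rewrite -g0 -Pc -[clamp t in LHS]mulr1 -[X in clamp t * X](subr0 1) -[in LHS](clamp0 R).
  rewrite -/(k 0).
  apply: (@lift_unique R X f A hX loc (fun u => Psi (k u) (g 1)) g 1 _ _ _ _ _ 0) => //.
  + move=> u; apply: (@continuous_comp _ _ _ k (Psi^~ (g 1))); first exact: ck.
    exact: cP.
  + by move=> u; rewrite fP fg1 gp.
  + by move=> u; rewrite fP fg1; exact: nAy.
  + by rewrite /k clamp1 subrr mulr0 P0.
Unshelve. all: end_near. Qed.

End IsotopyLifting.

(** * Path homotopies off the marked set *)

Section PathHomotopy.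
Variables (R : realType) (X : pseudoMetricType R).

(** In [H t s] the path parameter is [t] and the deformation parameter is [s]; in this order
    [homotopy_lift] applies directly and lifts the path [H^~ s] for each [s]. *)
Definition path_homotopic (A : set X) (a b : R -> X) := exists H : R -> R -> X,
  [/\ continuous (fun q : R * R => H q.1 q.2), forall t s, H (clamp t) s = H t s,
      forall t s, ~ A (H t s), forall t, H t 0 = a t /\ H t 1 = b t &
      forall s, H 0 s = a 0 /\ H 1 s = a 1].

Lemma path_homotopic_end A a b : path_homotopic A a b -> a 1 = b 1.
Proof. by move=> [H [_ _ _ /(_ 1)[_ <-] /(_ 1)[_ ->]]]. Qed.

Lemma path_homotopic_sub A B a b : A `<=` B -> path_homotopic B a b ->
  path_homotopic A a b.
Proof. by move=> AB [H [? ? HB ? ?]]; exists H; split => // t s /AB; exact: HB. Qed.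

Variables (f : X -> X) (A : set X).
Hypothesis hX : hausdorff_space X.
Hypothesis cX : compact [set: X].
Hypothesis cf : continuous f.
Hypothesis loc : forall z, ~ A (f z) -> local_section f z.

(** The ends of the lifted paths, as [s] varies, lift a constant path and so are constant: the
    lifted homotopy again fixes both ends. *)
Lemma path_homotopic_lift (a b g h : R -> X) : path_homotopic A a b ->
  continuous g -> continuous h -> (forall t, f (g t) = a t) -> (forall t, f (h t) = b t) ->
  g 0 = h 0 -> path_homotopic (f @^-1` A) g h.
Proof.
move=> [H [cH Hc HA Hab H01]] cg ch fg fh gh.
have [|s _||s _|L HL] := @homotopy_lift R X f A hX cX cf loc R H setT (fun=> g 0).
- by move=> s t _; split => //; exact: (cH (t, s)).
- by rewrite fg (H01 s).1.
- exact: openT.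
- exact: cvg_cst.
have cL t s : {for (t, s), continuous (fun q : R * R => L q.1 q.2)}.
  by have [_ _ _ ] := HL s I; exact.
have L0 s : L 0 s = g 0 by have [] := HL s I.
have fL t s : f (L t s) = H t s by have [] := HL s I.
have cL1 s : continuous (L^~ s).
  move=> t; apply: (@continuous_comp _ _ _ (fun t => (t, s)) (fun q => L q.1 q.2)).
    exact: continuous_pairl.
  exact: cL.
have cL2 t : continuous (L t).
  move=> s; apply: (@continuous_comp _ _ _ (fun s => (t, s)) (fun q => L q.1 q.2)).
    exact: continuous_pairr.
  exact: cL.
have Lg t : L t 0 = g t.
  apply: (@lift_unique R X f A hX loc (L^~ 0) g 0) => // u.
    by rewrite fL fg (Hab u).1.
  by rewrite fL.
have Lh t : L t 1 = h t.
  apply: (@lift_unique R X f A hX loc (L^~ 1) h 0) => [||u|u|] //.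
  - by rewrite fL fh (Hab u).2.
  - by rewrite fL.
  - by rewrite L0.
exists L; split => //.
- by move=> [t s]; exact: cL.
- by move=> t s; have [_ ->] := HL s I.
- by move=> t s /=; rewrite fL.
- move=> s; split=> //; rewrite -Lg.
  apply: (@lift_unique R X f A hX loc (L 1) (fun=> L 1 0) 0) => // [u|u|u].
  + exact: cvg_cst.
  + by rewrite !fL !(H01 _).2.
  + by rewrite fL.
Qed.

Lemma iter_lift_end (a b : nat -> R -> X) k : A `<=` f @^-1` A ->
  path_homotopic A (a 0%N) (b 0%N) ->
  (forall i, (i <= k)%N -> continuous (a i) /\ continuous (b i)) ->
  (forall i t, (i < k)%N -> f (a i.+1 t) = a i t /\ f (b i.+1 t) = b i t) ->
  (forall i, (i <= k)%N -> a i 0 = b i 0) -> a k 1 = b k 1.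
Proof.
move=> AA ab0 cab fab ab; apply: (@path_homotopic_end A).
elim: k cab fab ab => // k IH cab fab ab.
apply: (path_homotopic_sub AA).
apply: (@path_homotopic_lift (a k) (b k)).
- apply: IH => i *; [exact/cab/leqW|exact/fab/leqW|exact/ab/leqW].
- exact: (cab _ _).1.
- exact: (cab _ _).2.
- by move=> t; exact: (fab _ _ _).1.
- by move=> t; exact: (fab _ _ _).2.
- exact: ab.
Qed.

End PathHomotopy.

(** * Straight-line homotopies in complex charts *)

Section Disk.
Local Open Scope complex_scope.
Variable R : realType.

Lemma open_unit_disk : open (@unit_disk R).
Proof.
have -> : @unit_disk R = ball (0 : (R[i])^o) 1.
  by rewrite -ball_normE /ball_ /unit_disk; apply/seteqP; split=> z /=; rewrite sub0r normrN.
exact: ball_open.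
Qed.

Lemma continuous_real_complex : continuous (fun x : R => x%:C : (R[i])^o).
Proof.
move=> x; apply/cvgrPdist_lt => e e0.
have er : e = (complex.Re e)%:C.
  by move: e0; rewrite ltcE /= => /andP[/eqP + _]; case: e => ? ? /= ->.
have e1 : 0 < complex.Re e by move: e0; rewrite er ltcR.
near=> y.
rewrite -raddfB normc_def /= expr0n addr0 sqrtr_sqr er ltcR.
near: y; exact: cvgr_dist_lt.
Unshelve. all: end_near. Qed.

Lemma disk_convex (d z w : R[i]) (c : R) : 0 <= c <= 1 -> `|z| <= d -> `|w| <= d ->
  `|(1 - c)%:C * z + c%:C * w| <= d.
Proof.
move=> /andP[c0 c1] zd wd; apply: (le_trans (ler_normD _ _)).
have -> : d = (1 - c)%:C * d + c%:C * d by rewrite -mulrDl -raddfD /= subrK mul1r.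
by rewrite !normrM; apply: lerD; rewrite normc_def /= expr0n addr0 sqrtr_sqr
  ger0_norm ?subr_ge0 // ler_wpM2l // lecR ?subr_ge0.
Qed.

End Disk.

Section Chart.
Local Open Scope complex_scope.
Variables (R : realType) (X : pseudoMetricType R).

(** The chart may contain points of [A], so it is first cut down to a disk that misses them;
    convexity of that disk keeps the straight-line homotopy off [A]. *)
Lemma chart_path_homotopic (A U : set X) (phi : X -> (R[i])^o) p :
  closed A -> ~ A p -> open U -> U p -> homeo_between U (@unit_disk R) phi -> phi p = 0 ->
  exists2 W, nbhs p W & forall a b : R -> X, continuous a -> continuous b ->
    (forall t, a (clamp t) = a t) -> (forall t, b (clamp t) = b t) ->
    (forall t, W (a t)) -> (forall t, W (b t)) -> a 0 = b 0 -> a 1 = b 1 ->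
    path_homotopic A a b.
Proof.
move=> clA Ap oU Up [psi [cphi cpsi phiU psiU [psiK phiK]]] phi0.
have oD := @open_unit_disk R.
have D0 : @unit_disk R 0 by rewrite -phi0; exact: phiU.
have cpsi' : {in @unit_disk R, continuous psi} by rewrite -continuous_open_subspace.
have cphi' : {in U, continuous phi} by rewrite -continuous_open_subspace.
have /nbhs_ballP[d /= d0 dP] : \forall z \near (0 : (R[i])^o), @unit_disk R z /\ ~ A (psi z).
  near=> z; split; near: z; first exact: open_nbhs_nbhs.
  have cpsi0 := cpsi' _ (mem_set D0); apply: (cpsi0 (~` A)).
  by rewrite -phi0 psiK //; apply: open_nbhs_nbhs; split => //; rewrite openC.
have {}dP z : `|z| < d -> unit_disk z /\ ~ A (psi z).
  by move=> zd; apply: dP; rewrite -ball_normE /= sub0r normrN.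
have d20 : 0 < d / 2 by rewrite divr_gt0.
pose W := U `&` [set x | `|phi p - phi x| < d / 2].
exists W.
  have /cvgrPdist_lt/(_ _ d20) cphi0 := cphi' _ (mem_set Up).
  by apply: filterI => //; exact: open_nbhs_nbhs.
have Wn x : W x -> `|phi x| <= d / 2.
  by move=> [_]; rewrite /= phi0 sub0r normrN => /ltW.
move=> a b ca cb ac bc Wa Wb ab0 ab1.
pose m t s : (R[i])^o := (1 - clamp s)%:C *: phi (a t) + (clamp s)%:C *: phi (b t).
have md t s : `|m t s| < d.
  apply: (@le_lt_trans _ _ (d / 2)).
    apply: disk_convex; [exact: clamp_itv|exact: Wn|exact: Wn].
  by rewrite ltr_pdivrMr // ltr_pMr // ltr1n.
have m0 t : m t 0 = phi (a t) by rewrite /m clamp0 subr0 scale1r scale0r addr0.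
have m1 t : m t 1 = phi (b t) by rewrite /m clamp1 subrr scale1r scale0r add0r.
have msame s x : (1 - clamp s)%:C *: phi x + (clamp s)%:C *: phi x = phi x.
  by rewrite -scalerDl -raddfD /= subrK scale1r.
exists (fun t s => psi (m t s)); split.
- move=> q; apply: (@continuous_comp _ _ _ (fun q : R * R => m q.1 q.2) psi).
    have ck : {for q, continuous (fun q : R * R => clamp q.2)}.
      by apply: (@continuous_comp _ _ _ snd); [exact: cvg_snd|exact: continuous_clamp].
    apply: cvgD; apply: cvgZ.
    + apply: (@continuous_comp _ _ _ (fun q : R * R => 1 - clamp q.2)).
        by apply: cvgB => //; exact: cvg_cst.
      exact: continuous_real_complex.
    + apply: (@continuous_comp _ _ _ (a \o fst) phi).
        by apply: continuous_comp; [exact: cvg_fst|exact: ca].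
      by apply: cphi'; rewrite inE; case: (Wa q.1).
    + apply: (@continuous_comp _ _ _ (fun q : R * R => clamp q.2)) => //.
      exact: continuous_real_complex.
    + apply: (@continuous_comp _ _ _ (b \o fst) phi).
        by apply: continuous_comp; [exact: cvg_fst|exact: cb].
      by apply: cphi'; rewrite inE; case: (Wb q.1).
  by apply: cpsi'; rewrite inE; case: (dP _ (md q.1 q.2)).
- by move=> t s; rewrite /m ac bc.
- by move=> t s; case: (dP _ (md t s)).
- by move=> t; rewrite m0 m1 !psiK //; [case: (Wb t)|case: (Wa t)].
- move=> s; rewrite /m -ab0 -ab1 !msame !psiK //; [case: (Wa 1)|case: (Wa 0)] => //.
Unshelve. all: end_near. Qed.

End Chart.

(** * Branched coverings of the sphere *)

Section Sphere.
Variables (R : realType).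

Lemma hausdorff_sphere n : hausdorff_space (set_type (sphere R n)).
Proof.
rewrite open_hausdorff => x y xy.
have := @norm_hausdorff R 'rV[R]_n.+1; rewrite open_hausdorff.
move=> /(_ (val x) (val y)) []; first by rewrite (inj_eq val_inj).
move=> [P Q] /= [/set_mem Px /set_mem Qy] [oP oQ PQ].
exists (val @^-1` P, val @^-1` Q) => /=; first by split; apply/mem_set.
split; try by apply: open_comp => // z _; exact: initial_continuous.
by rewrite -preimage_setI (eqP PQ) preimage_set0.
Qed.

Lemma compact_sphere n : compact [set: set_type (sphere R n)].
Proof.
have cS : compact (sphere R n).
  apply: bounded_closed_compact.
    exists 1; split; first exact: num_real.
    move=> M M1 x Sx; rewrite {1}/Num.norm /= mx_normrE; apply/bigmax_leP; split.
      by apply/ltW/(lt_trans _ M1).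
    move=> [i j] _ /=; rewrite (ord1 i); apply/ltW/(le_lt_trans _ M1).
    rewrite -(@ler_pXn2r _ 2) ?nnegrE // expr1n real_normK ?num_real // -Sx.
    by rewrite (bigD1 j) //= lerDl; apply: sumr_ge0 => k _; exact: sqr_ge0.
  have -> : sphere R n = (fun x : 'rV[R]_n.+1 => \sum_i x ord0 i ^+ 2) @^-1` [set 1] by [].
  apply: closed_comp; last exact: closed_eq.
  have H r : continuous (fun x : 'rV[R]_n.+1 => \sum_(i <- r) x ord0 i ^+ 2).
    elim: r => [|i r IH].
      have -> : (fun x : 'rV[R]_n.+1 => \sum_(i <- [::]) x ord0 i ^+ 2) = fun=> 0.
        by apply/funext => x; rewrite big_nil.
      exact: cst_continuous.
    have -> : (fun x : 'rV[R]_n.+1 => \sum_(i <- i :: r) x ord0 i ^+ 2) =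
        (fun x => x ord0 i * x ord0 i + \sum_(i <- r) x ord0 i ^+ 2).
      by apply/funext => x; rewrite big_cons expr2.
    move=> x; apply: cvgD (IH x); apply: cvgM; exact: coord_continuous.
  by move=> x _; exact: H.
(* The topology on the type of points is induced from the row vectors, so near coverings transfer
   compactness from the subset to the type. *)
move/compact_near_coveringP in cS; apply/compact_near_coveringP.
move=> J F P FF H.
have : \forall i \near F,
    sphere R n `<=` (fun x => forall y : set_type (sphere R n), val y = x -> P i y).
  apply: cS.
  move=> x Sx; have [[U K] /= [nU nK] UK] := H (exist _ x (mem_set Sx)) I.
  case: nU => _ [[W oW <-] /= Wx WU].
  exists (W, K) => /=; first by split=> //; exact: open_nbhs_nbhs.
  move=> [x' i] /= [Wx' Ki] y yx'; apply: (UK (y, i)); split => //=.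
  by apply: WU; move: Wx'; rewrite -yx'.
by apply: filterS => i Hi y _; apply: (Hi (val y)) => //; exact/set_mem/valP.
Qed.

End Sphere.

(** On an infinite compact fibre the cofinite filter would cluster at a point of the fibre, which
    could then not be isolated. *)
Lemma finite_isolated_fiber (X : topologicalType) (Y : Type) (f : X -> Y) (y : Y) :
  compact (f @^-1` [set y]) ->
  (forall b, \forall x \near b, f x = f b -> x = b) -> finite_set (f @^-1` [set y]).
Proof.
move=> cK isol; apply: contrapT => nfin.
set K := f @^-1` [set y] in cK nfin.
pose F : set_system X := [set S | finite_set (K `\` S)].
have FF : ProperFilter F.
  split; first by rewrite /F /= setD0.
  split.
  - by rewrite /F /= setDT; exact: finite_set0.
  - by move=> S T FS FT; rewrite /F /= setDIr finite_setU.
  - by move=> S T ST; apply: sub_finite_set; exact: setDS.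
have FK : F K by rewrite /F /= setDv; exact: finite_set0.
have [x [Kx Fx]] := cK F FF FK.
have FKx : F (K `\` [set x]).
  apply: (@sub_finite_set _ _ [set x]); last exact: finite_set1.
  by move=> z [Kz nz]; apply: contrapT => zx; apply: nz.
have [z [[Kz zx] Uz]] := Fx _ _ FKx (isol x).
by apply: zx; apply: Uz; rewrite Kz Kx.
Qed.

Section Branched.
Variables (R : realType) (f : S2 R -> S2 R).

Lemma looks_like_power_isolated x d : (0 < d)%N -> looks_like_power f x d ->
  \forall z \near x, f z = f x -> z = x.
Proof.
move=> d0 [U [V [phi [psi [[oU Ux oV fUV] [[g [_ _ phiU _ [gK _]]] phix]
  [_ psix] psif]]]]].
near=> z => fz.
have Uz : U z by near: z; exact: open_nbhs_nbhs.
have := psif z Uz; rewrite fz psix => /esym/eqP; rewrite expf_eq0 d0 /= => /eqP pz.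
by rewrite -(gK z Uz) pz -phix gK.
Unshelve. all: end_near. Qed.

Lemma looks_like_power1_section x : looks_like_power f x 1 -> local_section f x.
Proof.
move=> [U [V [phi [psi [[oU Ux oV fUV]
  [[g [cphi cg phiU gU [gK phiK]]] phix]
  [[h [cpsi ch psiV hV [hK psiK]]] psix] psif]]]]].
have psi_inj : {in V &, injective psi}.
  by move=> u v /set_mem Vu /set_mem Vv e; rewrite -(hK u) // e hK.
have fV u : U u -> V (f u) by move=> Uu; apply: fUV; exists u.
have oD := @open_unit_disk R.
have cg' : {in @unit_disk R, continuous g} by rewrite -continuous_open_subspace.
have cpsi' : {in V, continuous psi} by rewrite -continuous_open_subspace.
exists U, V, (g \o psi); split => //=.
- move=> u Uu; split; first exact: fV.
  by rewrite psif // expr1 gK.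
- move=> v Vv; have Ug := gU _ (psiV _ Vv); split => //.
    apply: psi_inj; rewrite ?inE //; first exact: fV.
    by rewrite psif // expr1 phiK //; exact: psiV.
  apply: continuous_comp; first by apply: cpsi'; rewrite inE.
  by apply: cg'; rewrite inE; exact: psiV.
Qed.

Variable A : set (S2 R).
Hypothesis mf : marked_pcf f A.

Lemma marked_continuous : continuous f.
Proof. by case: mf => -[]. Qed.

(** A point of local degree above 1 is critical, so its value is postcritical and lies in [A].
    Otherwise the local degree is 1. *)
Lemma marked_section z : ~ A (f z) -> local_section f z.
Proof.
move=> Afz; case: mf => -[_ /(_ z) [d d0 ld]] _ PA _.
have [d1|d1] := ltnP 1 d; last first.
  by apply: looks_like_power1_section; have <- : d = 1%N by apply/eqP; rewrite eqn_leq d1.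
exfalso; apply: Afz; apply: PA; exists 1%N => //; exists z => //; by exists d.
Qed.

Lemma marked_isolated b : \forall x \near b, f x = f b -> x = b.
Proof.
case: mf => -[_ /(_ b) [d d0 ld]] _ _ _; exact: looks_like_power_isolated ld.
Qed.

Lemma marked_closed : closed A.
Proof.
case: mf => _ fA _ _.
have /accessible_finite_set_closed := hausdorff_accessible (@hausdorff_sphere R 2).
exact.
Qed.

Lemma marked_sub : A `<=` f @^-1` A.
Proof. by move=> a Aa; case: mf => _ _ _; apply; exists a. Qed.

Lemma marked_fiber y : finite_set (f @^-1` [set y]).
Proof.
have H : forall b, \forall x \near b, f x = f b -> x = b by exact: marked_isolated.
have cK : compact (f @^-1` [set y]).
  apply: (compact_preimage (@hausdorff_sphere R 2) (@compact_sphere R 2) marked_continuous).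
  exact: compact_set1.
exact: finite_isolated_fiber.
Qed.

Lemma marked_chart p : ~ A p -> exists2 W, nbhs p W &
  forall a b : R -> S2 R, continuous a -> continuous b ->
    (forall t, a (clamp t) = a t) -> (forall t, b (clamp t) = b t) ->
    (forall t, W (a t)) -> (forall t, W (b t)) -> a 0 = b 0 -> a 1 = b 1 ->
    path_homotopic A a b.
Proof.
move=> Ap; case: mf => -[_ /(_ p) [d d0 lp]] _ _ _.
have [U [V [phi [psi [[oU Ux oV fUV] [hphi phix] _ _]]]]] := lp.
exact: chart_path_homotopic marked_closed Ap oU Ux hphi phix.
Qed.

End Branched.

Lemma within_comp_continuous (X Y Z : topologicalType) (B : set Y) (g : Y -> Z)
    (h : X -> Y) : {within B, continuous g} -> continuous h -> (forall x, B (h x)) ->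
  continuous (g \o h).
Proof.
move=> /subspace_continuousP cg ch hB x U /(cg _ (hB x)) nU.
have : \forall x' \near x, B (h x') -> U (g (h x')) by exact: (ch x _ nU).
by apply: filterS => x' /= H; exact: H.
Qed.

Section Homeo.
Variable X : topologicalType.
Hypothesis hX : hausdorff_space X.
Implicit Types (h : X -> X) (C D : set X).

Lemma compact_homeo_between h C D : compact C -> {within C, continuous h} ->
  {in C &, injective h} -> h @` C = D -> homeo_between C D h.
Proof.
move=> cC ch hinj hC.
have /choice[k kP] : forall y, exists x, D y -> C x /\ h x = y.
  move=> y; have [|nD] := pselect (D y); last by exists y.
  by rewrite -hC => -[x Cx <-]; exists x.
have khK x : C x -> k (h x) = x.
  move=> Cx; have [|Ck e] := kP (h x); first by rewrite -hC; exists x.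
  by apply: hinj; rewrite ?inE.
exists k; split => //.
- apply/subspace_continuousP => y Dy U nU.
  have [Cy hy] := kP y Dy.
  have cCU : compact (C `&` ~` (U°)).
    apply: compact_closedI => //; apply: open_closedC; exact: open_interior.
  have cl : closed (h @` (C `&` ~` (U°))).
    apply: compact_closed => //; apply: continuous_compact => //.
    by apply: continuous_subspaceW ch; exact: subIsetl.
  have : nbhs y (~` (h @` (C `&` ~` (U°)))).
    apply: open_nbhs_nbhs; split; first by rewrite openC.
    by move=> [x [Cx nU']] hx; apply: nU'; rewrite -(khK x Cx) hx; exact: nU.
  rewrite /= /within /= nbhs_simpl /=; apply: filterS => z H Dz.
  apply: contrapT => nUz; apply: H; have [Cz hz] := kP z Dz.
  by exists (k z) => //; split => // /interior_subset.
- by move=> x Cx; rewrite -hC; exists x.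
- by move=> y /kP[].
- by split => // y /kP[].
Qed.

Hypothesis cX : compact [set: X].

Lemma bijective_homeo h : continuous h -> injective h -> (forall y, exists x, h x = y) ->
  exists k, [/\ continuous k, cancel h k & cancel k h].
Proof.
move=> ch hi hs.
have [|||k [_ ck _ _ [hk kh]]] := @compact_homeo_between h setT setT cX.
- exact: continuous_subspaceT.
- by move=> x y _ _; exact: hi.
- by apply/seteqP; split => // y _; have [x <-] := hs y; exists x.
- exists k; split.
  + exact/continuous_subspace_setT.
  + by move=> x; exact: hk.
  + by move=> x; exact: kh.
Qed.

Lemma homeo_component (h k : X -> X) (B : set X) x :
  continuous h -> continuous k -> cancel h k -> cancel k h ->
  h @` connected_component B x = connected_component (h @` B) (h x).
Proof.
move=> ch ck hk kh.
have [Bx|nBx] := pselect (B x); last first.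
  rewrite !connected_component_out ?image_set0 // => -[y By /(can_inj hk) e].
  by apply: nBx; rewrite -e.
apply/seteqP; split.
  apply: connected_component_max.
  - by exists x => //; exact: connected_component_refl.
  - by apply: image_subset; exact: connected_component_sub.
  - apply: connected_continuous_connected; first exact: component_connected.
    exact: continuous_subspaceT.
move=> z zC; exists (k z) => //.
have sub : k @` connected_component (h @` B) (h x) `<=` connected_component B x.
  apply: connected_component_max.
  - by exists (h x) => //; apply: connected_component_refl; exists x.
  - by move=> _ [y /connected_component_sub [w Bw <-] <-]; rewrite hk.
  - apply: connected_continuous_connected; first exact: component_connected.
    exact: continuous_subspaceT.
by apply: sub; exists z.
Qed.

Section Descendant.
Variable f : X -> X.

(** In substance a component of the preimage of [C] under the k-th iterate, built level by level
    because isotopies are lifted level by level. *)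
Fixpoint descendant C k D : Prop :=
  if k is k'.+1 then exists2 E, descendant C k' E & is_component (f @^-1` E) D
  else D = C.

Lemma descendant_iter C k D x : descendant C k D -> D x -> C (iter k f x).
Proof.
elim: k D x => [|k IH] D x /=; first by move=> ->.
move=> [E CE [y _ ->]] /connected_component_sub Ex.
by rewrite -iterS iterSr; exact: IH CE Ex.
Qed.

Lemma descendant_cat C k D m E : descendant C k D -> descendant D m E ->
  descendant C (k + m) E.
Proof.
move=> CD; elim: m E => [|m IH] E /=; first by move=> ->; rewrite addn0.
by move=> [F DF FE]; rewrite addnS; exists F => //; exact: IH.
Qed.

(** The condition on the roots is stated pointwise so that the roots may themselves be descendants,
    to which the lemma has already been applied. *)
Lemma descendant_eq C C' k D D' x : (forall y, C y -> C' y -> C = C') ->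
  descendant C k D -> descendant C' k D' -> D x -> D' x -> C = C' /\ D = D'.
Proof.
move=> CC; elim: k D D' x => [|k IH] D D' x /=.
  by move=> -> -> Cx C'x; have := CC _ Cx C'x.
move=> [E CE [y Ey ->]] [E' CE' [y' Ey' ->]] Dx D'x.
have [-> e] := IH _ _ (f x) CE CE' (connected_component_sub Dx) (connected_component_sub D'x).
split => //; rewrite e in Dx *.
rewrite (same_connected_component Dx); exact/esym/same_connected_component.
Qed.

Lemma descendant_path (R : realType) C k D (p : R -> X) : continuous f ->
  descendant C k D -> continuous p -> D (p 0) ->
  (forall t, C (iter k f (p t))) -> forall t, D (p t).
Proof.
move=> cf; elim: k D p => [|k IH] D p /=; first by move=> -> _ _ H.
move=> [E CE [x Ex DE]] cp Dp Cp t.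
have Ep : forall t, E (f (p t)).
  apply: (IH E (f \o p)) => //.
  - by move=> s; apply: continuous_comp; [exact: cp|exact: cf].
  - by have := Dp; rewrite DE => /connected_component_sub.
  - by move=> s /=; rewrite -iterSr; exact: Cp.
rewrite DE in Dp *; apply: (connected_component_trans Dp).
exists (range p); last by exists t.
split; first by exists 0.
- by move=> _ [s _ <-]; exact: Ep.
- apply: connected_continuous_connected; first exact/connected_intervalP.
  exact: continuous_subspaceT.
Qed.

End Descendant.
End Homeo.

(** * Isotopies and iterated preimage components *)

Section SphereIsotopy.
Variables (R : realType).
Implicit Types (A C D : set (S2 R)).

Lemma isotopy_at_continuous A (Phi : R -> S2 R -> S2 R) t : is_isotopy A Phi -> continuous (Phi t).
Proof.
move=> iP x; apply: (@continuous_comp _ _ _ (fun x => (t, x)) (fun q => Phi q.1 q.2)).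
  exact: continuous_pairr.
exact: (isotopy_continuous iP).
Qed.

Lemma isotopicP A C D : isotopic A C D <->
  exists2 Phi, is_isotopy A Phi & Phi 1 @` C = D.
Proof.
split=> [[Phi [cP hP relP P0 P1]]|[Phi iP PC]].
- exists (fun t => Phi (clamp t)); last by rewrite clamp1.
  have hc (t : R) : 0 <= clamp t <= 1 := clamp_itv t; split.
  + apply: (@within_comp_continuous _ _ _ _ _ (fun q : R * S2 R => (clamp q.1, q.2)) cP).
      move=> q; apply: (@continuous_pair _ _ _ (fun q : R * S2 R => clamp q.1) snd).
        by apply: (@continuous_comp _ _ _ fst); [exact: cvg_fst|exact: continuous_clamp].
      exact: cvg_snd.
    by move=> q; split => //=; rewrite in_itv /=; exact: hc.
  + by move=> t; rewrite clampK.
  + move=> t x y e; have [g [_ _ _ _ [gK _]]] := hP _ (hc t).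
    by rewrite -(gK x) // e gK.
  + move=> t y; have [g [_ _ _ _ [_ gK]]] := hP _ (hc t).
    by exists (g y); rewrite gK.
  + by move=> t a Aa; exact: relP.
  + by move=> x; rewrite clamp0 P0.
- have cPt t : continuous (Phi t) by exact: isotopy_at_continuous iP.
  exists Phi; split => //.
  + by apply: continuous_subspaceT; exact: (isotopy_continuous iP).
  + move=> t _; apply: compact_homeo_between.
    * exact: hausdorff_sphere.
    * exact: compact_sphere.
    * exact: continuous_subspaceT.
    * by move=> x y _ _; exact: (isotopy_inj iP).
    * by apply/seteqP; split => // y _; have [x <-] := isotopy_surj iP t y; exists x.
  + by move=> t a _; exact: (isotopy_rel iP).
  + by apply/funext => x; exact: (isotopy0 iP).
Qed.

Lemma isotopy_at_homeo A (Phi : R -> S2 R -> S2 R) t : is_isotopy A Phi ->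
  exists k, [/\ continuous k, cancel (Phi t) k & cancel k (Phi t)].
Proof.
move=> iP; apply: (bijective_homeo (@hausdorff_sphere R 2) (@compact_sphere R 2)).
- exact: isotopy_at_continuous iP.
- exact: isotopy_inj iP _.
- exact: isotopy_surj iP _.
Qed.

Lemma isotopic_sym A C D : isotopic A C D -> isotopic A D C.
Proof.
move=> /isotopicP[Phi iP <-]; apply/isotopicP.
have [k [ck Pk kP]] := isotopy_at_homeo 1 iP.
exists (fun t x => Phi (1 - clamp t) (k x)).
  split.
  - move=> q; apply: (@continuous_comp _ _ _
        (fun q : R * S2 R => (1 - clamp q.1, k q.2)) (fun q => Phi q.1 q.2)).
      apply: (@continuous_pair _ _ _ (fun q : R * S2 R => 1 - clamp q.1) (fun q => k q.2)).
        apply: cvgB; first exact: cvg_cst.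
        by apply: (@continuous_comp _ _ _ fst); [exact: cvg_fst|exact: continuous_clamp].
      by apply: (@continuous_comp _ _ _ snd); [exact: cvg_snd|exact: ck].
    exact: (isotopy_continuous iP).
  - by move=> t; rewrite clampK.
  - by move=> t x y /(isotopy_inj iP)/(can_inj kP).
  - move=> t y; have [x <-] := isotopy_surj iP (1 - clamp t) y.
    by exists (Phi 1 x); rewrite Pk.
  - move=> t b Ab; have {1}<- := isotopy_rel iP 1 Ab.
    by rewrite Pk (isotopy_rel iP).
  - by move=> x; rewrite clamp0 subr0 kP.
rewrite clamp1 subrr; apply/seteqP; split => [_ [_ [x Cx <-] <-]|x Cx].
  by rewrite Pk (isotopy0 iP).
by exists (Phi 1 x); [exists x|rewrite Pk (isotopy0 iP)].
Qed.

(** Running both isotopies simultaneously and composing them at each time avoids gluing in time. *)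
Lemma isotopic_trans A C D E : isotopic A C D -> isotopic A D E -> isotopic A C E.
Proof.
move=> /isotopicP[Phi iP <-] /isotopicP[Psi iQ <-]; apply/isotopicP.
exists (fun t x => Psi t (Phi t x)); last by rewrite image_comp.
split.
- move=> q; apply: (@continuous_comp _ _ _
      (fun q : R * S2 R => (q.1, Phi q.1 q.2)) (fun q => Psi q.1 q.2)).
    apply: (@continuous_pair _ _ _ fst (fun q : R * S2 R => Phi q.1 q.2)).
      exact: cvg_fst.
    exact: (isotopy_continuous iP).
  exact: (isotopy_continuous iQ).
- by move=> t; rewrite (isotopy_clamp iP) (isotopy_clamp iQ).
- by move=> t x y /(isotopy_inj iQ)/(isotopy_inj iP).
- move=> t z; have [y <-] := isotopy_surj iQ t z; have [x <-] := isotopy_surj iP t y.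
  by exists x.
- by move=> t b Ab; rewrite (isotopy_rel iP) // (isotopy_rel iQ).
- by move=> x; rewrite (isotopy0 iP) (isotopy0 iQ).
Qed.

(** The two half circles are graphs of a signed square root over [x = 2 t - 1]. They only serve to
    cut the curve into short arcs, so overlap at their ends is harmless. *)
Lemma simple_closed_curve_cover C : simple_closed_curve C ->
  exists h : bool -> R -> S2 R, [/\ forall b, continuous (h b),
    forall b t, h b (clamp t) = h b t & forall x, C x <-> exists b t, h b t = x].
Proof.
move=> [c [cc _ <-]].
pose x t : R := 2 * clamp t - 1.
have x1 t : 0 <= 1 - x t ^+ 2.
  have /andP[? ?] := clamp_itv t.
  have -> : 1 - x t ^+ 2 = 4 * clamp t * (1 - clamp t) by rewrite /x; ring.
  by rewrite !mulr_ge0 // subr_ge0.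
have cx : continuous x.
  move=> t; apply: cvgB; last exact: cvg_cst.
  by apply: cvgM; [exact: cvg_cst|exact: continuous_clamp].
have cy (b : bool) : continuous (fun t => (-1) ^+ b * Num.sqrt (1 - x t ^+ 2)).
  move=> t; apply: cvgM; first exact: cvg_cst.
  apply: (@continuous_comp _ _ _ (fun t => 1 - x t ^+ 2)); last exact: sqrt_continuous.
  apply: cvgB; first exact: cvg_cst.
  by rewrite !expr2; apply: cvgM; exact: cx.
pose v (b : bool) t : 'rV[R]_2 :=
  \row_j (if j == ord0 then x t else (-1) ^+ b * Num.sqrt (1 - x t ^+ 2)).
have vS b t : v b t \in sphere R 1.
  rewrite inE /sphere /= !big_ord_recl big_ord0 !mxE /= addr0 exprMn sqr_sqrtr //.
  by rewrite -signr_odd /= sqrr_sign mul1r addrC subrK.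
exists (fun b t => c (exist _ (v b t) (vS b t))); split.
- move=> b t.
  apply: (@continuous_comp _ _ _ (fun t => exist _ (v b t) (vS b t) : S1 R) c); last exact: cc.
  move: t; apply: continuous_comp_initial => t; apply/cvg_ballP => e e0.
  have /cvg_ballP/(_ _ e0) nx := cx t; have /cvg_ballP/(_ _ e0) ny := cy b t.
  near=> s; split=> // i j; rewrite /= !set_valE /= !mxE.
  case: ifP => _; first by near: s.
  by near: s.
- by move=> b t; congr c; apply: val_inj => /=; rewrite /v /x clampK.
- move=> z; split => [[u _ <-]|[b [t <-]]]; last by exists (exist _ (v b t) (vS b t)).
  case: u => u Su; have := set_mem Su; rewrite /sphere /= !big_ord_recl big_ord0 addr0 => u1.
  set p := u ord0 ord0 in u1; set q := u ord0 (lift _ _) in u1.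
  have p1 : -1 <= p <= 1.
    rewrite -ler_norml -(@ler_pXn2r _ 2) ?nnegrE // expr1n real_normK ?num_real //.
    by rewrite -u1 lerDl sqr_ge0.
  exists (q < 0), ((p + 1) / 2); congr c; apply: val_inj => /=.
  have xp : x ((p + 1) / 2) = p.
    rewrite /x clamp_id; first by field.
    by case/andP: p1 => ? ?; apply/andP; split; lra.
  apply/rowP => j; rewrite !mxE xp; case: eqVneq => [->//|j0].
  have -> : j = lift ord0 ord0 by apply: val_inj; case: j j0 => -[|[|]].
  have -> : 1 - p ^+ 2 = q ^+ 2 by rewrite -u1 addrC addKr.
  by rewrite sqrtr_sqr -/q mulr_sign_norm.
Unshelve. all: end_near. Qed.

End SphereIsotopy.

Section SphereDescendant.
Variables (R : realType) (f : S2 R -> S2 R) (A : set (S2 R)).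
Hypothesis mf : marked_pcf f A.

(** One [Psi] serves all descendants of level [k] simultaneously. Lifts fix the preimage of [A] and
    hence [A], so the lifting can be repeated. *)
Lemma descendant_isotopy (Phi : R -> S2 R -> S2 R) C k : is_isotopy A Phi ->
  exists2 Psi, is_isotopy A Psi &
    forall D, descendant f C k D -> descendant f (Phi 1 @` C) k (Psi 1 @` D).
Proof.
move=> iP; elim: k => [|k [Psi iQ H]]; first by exists Phi => // D /= ->.
have [Xi iX XiE] := @isotopy_lift R (S2 R) f A (@hausdorff_sphere R 2) (@compact_sphere R 2)
  (marked_continuous mf) (marked_section mf) (marked_closed mf) 
  (fun b _ => marked_isolated mf b) Psi iQ.
have iX' : is_isotopy A Xi.
  by case: iX => a1 a2 a3 a4 a5 a6; split => // t b Ab; apply: a5; exact: (marked_sub mf).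
exists Xi => // D /= [E CE [x Ex ->]].
exists (Psi 1 @` E); first exact: H.
have [h [ch hK Kh]] := isotopy_at_homeo 1 iX.
exists (Xi 1 x); first by rewrite /= XiE; exists (f x).
rewrite (homeo_component _ _ (isotopy_at_continuous (t := 1) iX) ch hK Kh).
congr (connected_component _ _); apply/seteqP; split => [_ [y Ey <-]|y /= [z Ez]].
  by rewrite /= XiE; exists (f y).
rewrite -(Kh y) XiE => /(isotopy_inj iQ) e; exists (h y); rewrite ?Kh //=.
by rewrite -e.
Qed.

End SphereDescendant.

(** * Exponential against polynomial growth, and the number of walks *)

Section Combinatorics.
Local Open Scope nat_scope.

Lemma leq_sqr_exp2 p : 3 < p -> p * p <= 2 ^ p.
Proof.
elim: p => // p IH; rewrite ltnS leq_eqVlt => /predU1P[<- //|p3].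
by have := IH p3; rewrite expnS; nia.
Qed.

Lemma exp2_beats_poly a b C D : exists m, C * (a * m + b) ^ D < 2 ^ m.
Proof.
pose C' := C * (a + b) ^ D.
(* With [m = 2 ^ p - 1] the polynomial is at most [2 ^ (C' + p * D)]. The summand 4 gives
   [p * p <= 2 ^ p], and this choice of [p] makes [C' + p * D] smaller than [p * p]. *)
pose p := (D + C' + 4)%N.
exists (2 ^ p).-1.
have p0 : 0 < 2 ^ p by rewrite expn_gt0.
have le1 : a * (2 ^ p).-1 + b <= (a + b) * 2 ^ p by nia.
apply: (@leq_ltn_trans (C' * (2 ^ p) ^ D)).
  rewrite /C' -mulnA -expnMn leq_mul2l; apply/orP; right.
  by case: (posnP D) => [->//|D0]; rewrite leq_exp2r.
have C2 : C' < 2 ^ C' by apply: ltn_expl.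
apply: (@leq_trans (2 ^ C' * (2 ^ p) ^ D)).
  by rewrite ltn_mul2r C2 expn_gt0 p0.
rewrite -expnM -expnD leq_exp2l //.
have : p * p <= 2 ^ p by apply: leq_sqr_exp2; rewrite /p addnS ltnS leq_addl.
by rewrite /p; nia.
Qed.

Section Walks.
Variables (T : finType) (E : rel T).

Definition walk n (w : nat -> T) := forall i, i < n -> E (w i) (w i.+1).

(** The combinatorial form of zero entropy. *)
Hypothesis closed_walk_unique : forall n w w', walk n w -> walk n w' ->
  w 0 = w n -> w' 0 = w' n -> w 0 = w' 0 -> forall i, i <= n -> w i = w' i.

(** For a vertex that is never visited the empty maximum gives 0; decoding consults visited vertices
    only. *)
Definition last_visit k (w : nat -> T) u : 'I_k.+1 :=
  inord (\max_(i < k.+1 | w i == u) i).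

Lemma last_visitP k w t : t <= k ->
  w (last_visit k w (w t)) = w t /\ t <= last_visit k w (w t) <= k.
Proof.
move=> tk; have t0 : w (Ordinal (tk : t < k.+1)) == w t by [].
have [j wj e] := @eq_bigmax_cond _ (fun i : 'I_k.+1 => w i == w t) (@nat_of_ord _)
  ltac:(by apply/card_gt0P; exists (Ordinal (tk : t < k.+1))).
rewrite /last_visit; set L := \max_(i < _ | _) _ in e *.
have Lk : L < k.+1 by rewrite e.
rewrite inordK //; split; first by rewrite e; exact/eqP.
apply/andP; split => //.
exact: (@leq_bigmax_cond _ (fun i : 'I_k.+1 => w i == w t) (@nat_of_ord _)
  (Ordinal (tk : t < k.+1))).
Qed.

(* Between two visits of a vertex a walk is closed, hence determined: it is
   enough to remember when each vertex is left for good, and where to. *)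
Definition walk_code k (w : nat -> T) : T * {ffun T -> 'I_k.+1 * T} :=
  (w 0, [ffun u => (last_visit k w u, w (last_visit k w u).+1)]).

Lemma walk_code_inj k w w' : walk k w -> walk k w' -> walk_code k w = walk_code k w' ->
  forall i, i <= k -> w i = w' i.
Proof.
move=> Ww Ww' [e0 /ffunP ec]; elim=> [//|t IH] tk.
have wt := IH (ltnW tk).
have [wL /andP[tL Lk]] := last_visitP w (ltnW tk).
have [wL' _] := last_visitP w' (ltnW tk).
have := ec (w t); rewrite !ffunE => -[eL en].
rewrite -wt -(f_equal val eL) /= in wL'.
(* If [t] is the last visit, the code records the next vertex. Otherwise both walks return to [w t]
   at the same later time, and the two closed segments coincide. *)
case: ltngtP tL => // [tL _|tL _]; last first.
  move: en; rewrite -(f_equal val eL) /=.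
  by rewrite -tL.
set L : nat := last_visit k w (w t) in tL Lk wL wL'.
have := @closed_walk_unique (L - t) (fun i => w (t + i)) (fun i => w' (t + i)).
rewrite addn0 subnKC ?(ltnW tL) //; move/(_ _ _ _ _ _ 1%N); rewrite addn1; apply.
- by move=> i iL; rewrite addnS; apply: Ww; lia.
- by move=> i iL; rewrite addnS; apply: Ww'; lia.
- by rewrite wL.
- by rewrite -wt wL'.
- by [].
- lia.
Qed.

Lemma card_walk_code k : #|{: T * {ffun T -> 'I_k.+1 * T}}| = #|T| * (k.+1 * #|T|) ^ #|T|.
Proof. by rewrite card_prod card_ffun card_prod card_ord. Qed.

End Walks.

End Combinatorics.

Lemma descendant_nonempty (X : topologicalType) (f : X -> X) C k D :
  C !=set0 -> descendant f C k D -> D !=set0.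
Proof.
case: k => [|k] C0 /=; first by move=> ->.
by move=> [E _ [x Ex ->]]; exists x; exact: connected_component_refl.
Qed.

(** * Exponentially many descendants from one branching *)

Section Growth.
Variables (R : realType) (f : S2 R -> S2 R) (A : set (S2 R)).
Hypothesis mf : marked_pcf f A.

Lemma isotopic_refl C : isotopic A C C.
Proof.
apply/isotopicP; exists (fun _ => id); last by rewrite image_id.
split => //; first by move=> q; exact: cvg_snd.
  by move=> _ x y.
by move=> _ y; exists y.
Qed.

(** [Th] takes images under a single homeomorphism, hence is injective on all sets; copies of
    distinct components remain distinct. *)
Lemma descendant_transport C D k : isotopic A C D ->
  exists2 Th : set (S2 R) -> set (S2 R), injective Th &
    forall E, descendant f C k E -> descendant f D k (Th E) /\ isotopic A (Th E) E.
Proof.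
move=> /isotopicP[Phi iP <-].
have [Psi iQ H] := descendant_isotopy mf C k iP.
exists (fun E => Psi 1 @` E).
  move=> E E' e; apply/seteqP; split => x Ex.
    have : (Psi 1 @` E') (Psi 1 x) by rewrite -e; exists x.
    by move=> [y E'y /(isotopy_inj iQ) <-].
  have : (Psi 1 @` E) (Psi 1 x) by rewrite e; exists x.
  by move=> [y E'y /(isotopy_inj iQ) <-].
move=> E CE; split; first exact: H.
by apply: isotopic_sym; apply/isotopicP; exists Psi.
Qed.

Lemma descendant_compose C D k m E F : descendant f C k D -> isotopic A D E ->
  descendant f E m F -> exists2 F', descendant f C (k + m) F' & isotopic A F' F.
Proof.
move=> CD DE EF; have [Th _ H] := descendant_transport m (isotopic_sym DE).
have [DF iF] := H _ EF.
by exists (Th F) => //; exact: descendant_cat CD DF.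
Qed.

Lemma descendant_power C n D m : descendant f C n D -> isotopic A D C ->
  exists2 D', descendant f C (m * n) D' & isotopic A D' C.
Proof.
move=> CD DC; elim: m => [|m [E CE EC]].
  by exists C => //; exact: isotopic_refl.
have [F CF FD] := descendant_compose CE EC CD.
exists F; first by rewrite mulSn addnC.
exact: isotopic_trans FD DC.
Qed.

(** A binary tree of descendants: every node is isotopic to [C], so copies of [D0] and [D1] can be
    transported below it. Words with different tails have different ancestors, and words with equal
    tails are told apart by injectivity of the transport. *)
Lemma descendant_branch C n D0 D1 r E m : C !=set0 ->
  descendant f C n D0 -> descendant f C n D1 -> isotopic A D0 C -> isotopic A D1 C ->
  D0 <> D1 -> descendant f C r E ->
  exists F : m.-tuple bool -> set (S2 R), injective F /\
    forall s, descendant f C (m * n + r) (F s) /\ isotopic A (F s) E.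
Proof.
move=> C0 CD0 CD1 i0 i1 D01 CE.
have tr k : exists Th : set (S2 R) -> set (S2 R) -> set (S2 R),
    forall D, isotopic A D C -> injective (Th D) /\
      forall E, descendant f C k E -> descendant f D k (Th D E) /\ isotopic A (Th D E) E.
  have /choice[Th H] : forall D, exists Th : set (S2 R) -> set (S2 R), isotopic A D C ->
    injective Th /\
      forall E, descendant f C k E -> descendant f D k (Th E) /\ isotopic A (Th E) E.
    move=> D; have [iD|nD] := pselect (isotopic A D C); last by exists id.
    by have [Th ? ?] := descendant_transport k (isotopic_sym iD); exists Th.
  by exists Th.
(* A nonempty descendant determines its ancestor at each level, since distinct components of one
   level are disjoint. *)
have inj_step k D D' G x : descendant f C k D -> descendant f C k D' ->
    forall l, descendant f D l G -> descendant f D' l G -> G x -> D = D'.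
  move=> CD CD' l DG D'G Gx.
  have CC y : C y -> C y -> C = C by [].
  have [] // := descendant_eq (x := x) _ DG D'G Gx Gx.
  by move=> y Dy D'y; have [] := descendant_eq CC CD CD' Dy D'y.
have [Th HTh] := tr n.
pose D b := if b then D1 else D0.
have CDb b : descendant f C n (D b) by case: b.
have iDb b : isotopic A (D b) C by case: b.
pose F := fix F (s : seq bool) := if s is b :: s' then Th (F s') (D b) else C.
have HF s : descendant f C (size s * n) (F s) /\ isotopic A (F s) C.
  elim: s => [|b s [CF iF]] /=; first by split => //; exact: isotopic_refl.
  have [_ H] := HTh _ iF; have [FF iT] := H _ (CDb b).
  split; last exact: isotopic_trans iT (iDb b).
  by rewrite mulSn addnC; exact: descendant_cat FF.
have F0 s : F s !=set0 by apply: descendant_nonempty C0 (HF s).1.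
have injF s s' : size s = size s' -> F s = F s' -> s = s'.
  elim: s s' => [|b s IH] [|b' s'] //= [ss] e.
  have [CF iF] := HF s; have [CF' iF'] := HF s'.
  have [iTh H] := HTh _ iF; have [_ H'] := HTh _ iF'.
  have [x Fx] := F0 (b :: s).
  have Fs : F s = F s'.
    rewrite -ss in CF'.
    apply: (inj_step _ _ _ _ _ CF CF' n _ _ Fx); first exact: (H _ (CDb b)).1.
    by rewrite /= e; exact: (H' _ (CDb b')).1.
  rewrite -(IH _ ss Fs); congr (_ :: _).
  rewrite -Fs in e; move: (iTh _ _ e); rewrite /D.
  by case: b {e Fx}; case: b' => // e; case: D01.
have [Th' HTh'] := tr r.
exists (fun s => Th' (F s) E); split.
  move=> s s' e.
  have [CF iF] := HF s; have [CF' iF'] := HF s'.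
  have [_ H] := HTh' _ iF; have [_ H'] := HTh' _ iF'.
  have [FE _] := H _ CE; have [FE' _] := H' _ CE.
  have [x Ex] := descendant_nonempty (F0 s) FE.
  rewrite !size_tuple in CF CF'.
  apply: val_inj; apply: injF; rewrite ?size_tuple //.
  by apply: (inj_step _ _ _ _ _ CF CF' r FE _ Ex); rewrite e.
move=> s; have [CF iF] := HF s; rewrite size_tuple in CF.
have [_ H] := HTh' _ iF; have [FE iE] := H _ CE.
split => //; exact: descendant_cat FE.
Qed.

Variables (n : nat) (gam : 'I_n -> set (S2 R)).
Hypothesis mg : multicurve A gam.
Hypothesis irr : irreducible_multicurve f A gam.
Let T := thurston_matrix f A gam.

Lemma multicurve_nonempty i : gam i !=set0.
Proof.
have [/simple_closed_curve_cover[h [_ _ H]] _ _ _] := mg.1 i.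
by exists (h true 0); apply/H; exists true, 0.
Qed.

Lemma thurston_entry i j : T i j != 0 -> exists C',
  is_component (f @^-1` gam j) C' /\ isotopic A C' (gam i).
Proof.
rewrite mxE; apply: contraNP => nC.
by rewrite (_ : [set C' | _] = set0) ?fsbig_set0 // -subset0 => C' H; apply: nC; exists C'.
Qed.

Lemma thurston_power k i j : (T ^+ k) i j != 0 ->
  exists2 D, descendant f (gam j) k D & isotopic A D (gam i).
Proof.
elim: k i => [|k IH] i.
  rewrite expr0 mxE; case: (eqVneq i j) => [-> _|_]; last by rewrite mulr0n eqxx.
  by exists (gam j) => //; exact: isotopic_refl.
rewrite exprS -mulmxE mxE => H.
have [l Hl] : exists l, T i l * (T ^+ k) l j != 0.
  apply: contrapT => nl; move/eqP: H; apply; apply: big1 => l _.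
  by apply/eqP; apply: contrapT => /negP ?; apply: nl; exists l.
move: Hl; rewrite mulf_eq0 negb_or => /andP[/thurston_entry[C' [cC' iC']] /IH[D CD iD]].
have lC' : descendant f (gam l) 1 C' by exists (gam l).
have [F DF iF] := descendant_compose CD iD lC'.
by exists F; [rewrite -(addn1 k)|exact: isotopic_trans iF iC'].
Qed.

Lemma irreducible_descendant i j : exists2 k, (0 < k)%N &
  exists2 D, descendant f (gam j) k D & isotopic A D (gam i).
Proof.
by have [k k0 /lt0r_neq0 H] := irr i j; exists k => //; exact: thurston_power.
Qed.

Lemma branching_growth j C' C'' i i' i0 :
  is_component (f @^-1` gam j) C' -> is_component (f @^-1` gam j) C'' -> C' <> C'' ->
  isotopic A C' (gam i) -> isotopic A C'' (gam i') ->
  exists a b, forall m, exists F : m.-tuple bool -> set (S2 R), injective F /\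
    forall s, descendant f (gam j) (m * a + b) (F s) /\ isotopic A (F s) (gam i0).
Proof.
move=> cC' cC'' C'C'' iC' iC''.
have jC' : descendant f (gam j) 1 C' by exists (gam j).
have jC'' : descendant f (gam j) 1 C'' by exists (gam j).
have step B l : isotopic A B (gam l) -> exists2 k, (0 < k)%N &
    exists2 D, descendant f B k D & isotopic A D (gam j).
  move=> iB; have [k k0 [D lD iD]] := irreducible_descendant j l.
  exists k => //; have B0 : descendant f B 0 B by [].
  by have [F ? ?] := descendant_compose B0 iB lD; exists F => //; exact: isotopic_trans iD.
have [k1 _ [D1 C'D1 iD1]] := step _ _ iC'.
have [k2 _ [D2 C''D2 iD2]] := step _ _ iC''.
have jD1 := descendant_cat jC' C'D1; have jD2 := descendant_cat jC'' C''D2.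
(* The returns through [C'] and [C''] have lengths [1 + k1] and [1 + k2]. Repeating the first
   [1 + k2] times and the second [1 + k1] times brings both to the common level
   [(1 + k1) * (1 + k2)]. *)
have [E1 jE1 iE1] := descendant_power k2 jD1 iD1.
have [E2 jE2 iE2] := descendant_power k1 jD2 iD2.
have [F1 C'F1 iF1] := descendant_compose C'D1 iD1 jE1.
have [F2 C''F2 iF2] := descendant_compose C''D2 iD2 jE2.
have lvl : (k1 + k2 * (1 + k1) = k2 + k1 * (1 + k2))%N by lia.
rewrite -lvl in C''F2.
have [b _ [E jE iE]] := irreducible_descendant i0 j.
exists (1 + (k1 + k2 * (1 + k1)))%N, b => m.
have [|||F [injF HF]] := @descendant_branch (gam j) _ F1 F2 b E m (multicurve_nonempty j)
  (descendant_cat jC' C'F1) (descendant_cat jC'' C''F2) _ _ _ jE.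
- exact: isotopic_trans iF1 iE1.
- exact: isotopic_trans iF2 iE2.
- move=> e; apply: C'C''.
  have [x Cx] := descendant_nonempty (descendant_nonempty (multicurve_nonempty j) jC') C'F1.
  rewrite -e in C''F2.
  have [] // := descendant_eq (x := x) _ C'F1 C''F2 Cx Cx.
  by move=> y y1 y2; have [] := descendant_eq (fun z _ _ => erefl (gam j)) jC' jC'' y1 y2.
- exists F; split => // s; have [? iFs] := HF s; split => //.
  exact: isotopic_trans iFs iE.
Qed.

End Growth.

(** * Thurston matrices with one component per curve *)

Section WeightedPermutation.
Local Open Scope complex_scope.

(** Following an eigenvector once around a cycle through [j0] multiplies it by [z ^+ N] and by the
    product [P] of the weights met, so every eigenvalue satisfies [z ^+ N = P], with [P < 1] because
    [w j0] is a factor. *)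
Lemma spectral_radius_weighted_permutation (R : realType) n (T : 'M[R]_n) (s : 'I_n -> 'I_n)
    (w : 'I_n -> R) j0 :
  (forall i j, T i j = if i == s j then w j else 0) ->
  (forall i j, exists2 k, (0 < k)%N & i = iter k s j) ->
  (forall j, 0 < w j <= 1) -> w j0 < 1 -> spectral_radius T < 1.
Proof.
move=> Tw orb w01 wj0.
have [N N0 jN] := orb j0 j0.
pose P := \prod_(k < N) w (iter k s j0).
have P1 : P < 1.
  rewrite /P; case: N N0 {jN P} => // N _; rewrite big_ord_recl /=.
  apply: le_lt_trans wj0; rewrite ler_piMr //; first by have /andP[/ltW] := w01 j0.
  by apply: prodr_ile1 => k _; have /andP[/ltW-> ->] := w01 (iter (lift ord0 k) s j0).
rewrite /spectral_radius; set S := (X in sup X).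
have SP a : S a -> 0 <= a /\ a ^+ N = P.
  case=> z ev <-; have /eigenvalueP[v vT v0] : eigenvalue (map_mx (real_complex R) T) z by [].
  clear ev.
  have step j : v ord0 (s j) * (w j)%:C = z * v ord0 j.
    move/rowP: vT => /(_ j); rewrite !mxE => <-.
    rewrite (bigD1 (s j)) //= big1 ?addr0; first by rewrite mxE Tw eqxx.
    by move=> i ij; rewrite mxE Tw (negbTE ij) /= mulr0.
  have iters k j : v ord0 (iter k s j) * (\prod_(l < k) w (iter l s j))%:C = z ^+ k * v ord0 j.
    elim: k => [|k IH]; first by rewrite big_ord0 expr0 mulr1 mul1r.
    rewrite big_ord_recr /= exprS -mulrA -IH rmorphM [X in _ * X = _]mulrC mulrA.
    by rewrite step mulrA.
  have vj0 : v ord0 j0 != 0.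
    apply: contraNneq v0 => vj; apply/eqP/rowP => i; rewrite mxE.
    have [k _ ->] := orb i j0; have := iters k j0; rewrite vj mulr0 => /eqP.
    rewrite mulf_eq0 => /orP[/eqP//|].
    rewrite (_ : 0 = (0 : R)%:C) // (inj_eq (@complexI R)) prodf_seq_eq0 => /hasP[l _ /=] /eqP wl.
    by have := w01 (iter l s j0); rewrite wl ltxx.
  have zN : z ^+ N = P%:C.
    by apply: (mulIf vj0); rewrite -iters -jN mulrC.
  have zn : `|z| = (complex.Re `|z|)%:C by rewrite normc_def.
  split; first by case: (z) => x y; rewrite normc_def /= sqrtr_ge0.
  have P0 : 0 <= P by apply: prodr_ge0 => k _; have /andP[/ltW] := w01 (iter k s j0).
  apply: (@complexI R); rewrite rmorphXn /= -zn -normrX zN.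
  by rewrite normc_def /= expr0n addr0 sqrtr_sqr ger0_norm.
(* Existence of an eigenvalue need not be shown: the supremum of the empty set is 0, which is also
   below 1. *)
have [[a Sa]|nS] := pselect (S !=set0); last first.
  suff -> : S = set0 by rewrite sup0.
  by rewrite -subset0 => a Sa; apply: nS; exists a.
have [a0 aN] := SP _ Sa.
have -> : S = [set a].
  apply/seteqP; split => [b Sb|b ->//]; have [b0 bN] := SP _ Sb.
  by apply/eqP; rewrite -(@eqrXn2 _ N) ?nnegrE //; rewrite bN aN.
rewrite sup1 ltNge; apply/negP => a1.
by move: P1; rewrite -aN ltNge exprn_ege1.
Qed.

End WeightedPermutation.

(** Transitivity makes [s] onto, hence injective by finiteness, and the orbit of [j0] has exactly
    [n] elements, so listing it closes up under [ordS]. *)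
Lemma cyclic_order n (s : 'I_n -> 'I_n) (j0 : 'I_n) :
  (forall i j, exists2 k, (0 < k)%N & i = iter k s j) ->
  exists p : 'S_n, forall i, p (ordS i) = s (p i).
Proof.
move=> orb.
have s_surj i : exists j, s j = i.
  by have [[//|k] _ ->] := orb i i; exists (iter k s i).
have /choice[g gK] := s_surj.
have s_inj : injective s.
  have g_inj : injective g by exact: (can_inj gK).
  have [h hK Kh] := injF_bij g_inj.
  by move=> x y e; rewrite -(Kh x) -(Kh y) -[h x]gK -[h y]gK !Kh e.
have conn i : fconnect s j0 i by have [k _ ->] := orb i j0; exact: fconnect_iter.
have ord_n : order s j0 = n.
  by rewrite /order -[RHS]card_ord; apply: eq_card => i; rewrite !inE conn.
pose p (i : 'I_n) := iter i s j0.
have p_inj : injective p.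
  move=> x y e; apply: val_inj; rewrite /= -(@findex_iter _ s j0 x) ?ord_n //.
  by rewrite -/(p x) e findex_iter // ord_n.
exists (perm p_inj) => i; rewrite !permE /p /=.
have := ltn_ord i; rewrite leq_eqVlt => /predU1P[e|lt]; last by rewrite modn_small.
by rewrite -iterS e modnn /=; have := iter_order s_inj j0; rewrite ord_n => ->.
Qed.

Section Levy.
Local Open Scope card_scope.
Variables (R : realType) (f : S2 R -> S2 R) (A : set (S2 R)).
Hypothesis mf : marked_pcf f A.

(* [cover_degree] is [0] when no degree exists, so the value [1] certifies that
   every fibre is a singleton. *)
Lemma cover_degree1_homeo C C' : simple_closed_curve C -> is_component (f @^-1` C) C' ->
  cover_degree f C' C = 1%N -> homeo_between C' C f.
Proof.
move=> [c [cc _ cC]] [x Cx C'E] d1.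
have clC : closed C.
  apply: compact_closed; first exact: hausdorff_sphere.
  rewrite -cC; apply: continuous_compact; first exact: continuous_subspaceT.
  exact: compact_sphere.
have card1 y : C y -> (C' `&` f @^-1` [set y]) #= `I_1.
  move: d1; rewrite /cover_degree; case: xgetP => [d -> H d1|_ //].
  by move: y; rewrite d1 in H.
have one y : C y -> exists z, C' `&` f @^-1` [set y] = [set z].
  move=> /card1/eq_cardSP[z Kz]; rewrite II0 card_eq0 => /eqP K0.
  exists z; apply/seteqP; split => [u Ku|_ ->//]; apply: contrapT => uz.
  by have : (set0 : set (S2 R)) u by rewrite -K0.
apply: compact_homeo_between.
- exact: hausdorff_sphere.
- apply: (subclosed_compact _ (@compact_sphere R 2)) => //; rewrite C'E.
  apply: component_closed; apply: closed_comp => // z _; exact: marked_continuous mf _.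
- by apply: continuous_subspaceT; exact: marked_continuous mf.
- move=> u v /set_mem C'u /set_mem C'v e.
  have Cu : C (f u) by move: C'u; rewrite C'E => /connected_component_sub.
  have [z Hz] := one _ Cu.
  have : [set z] u by rewrite -Hz.
  have : [set z] v by rewrite -Hz.
  by move=> -> ->.
- apply/seteqP; split => [_ [u C'u <-]|y Cy].
    by move: C'u; rewrite C'E => /connected_component_sub.
  have [z Hz] := one _ Cy.
  have : (C' `&` f @^-1` [set y]) z by rewrite Hz.
  by move=> [? <-]; exists z.
Qed.

Variables (n : nat) (gam : 'I_n -> set (S2 R)).
Hypothesis mg : multicurve A gam.
Hypothesis irr : irreducible_multicurve f A gam.
Let T := thurston_matrix f A gam.

Lemma levy_of_unique_components (j0 : 'I_n) :
  1 <= spectral_radius T ->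
  (forall j C' C'' i i', is_component (f @^-1` gam j) C' -> is_component (f @^-1` gam j) C'' ->
     isotopic A C' (gam i) -> isotopic A C'' (gam i') -> C' = C'') ->
  levy_cycle f A gam.
Proof.
move=> rad uniq.
have child j : exists p : 'I_n * set (S2 R),
    [/\ is_component (f @^-1` gam j) p.2, isotopic A p.2 (gam p.1) & T p.1 j != 0].
  have [[//|k] _] := irr j j; rewrite exprSr -mulmxE mxE => /lt0r_neq0 H.
  have [l Hl] : exists l, T l j != 0.
    apply: contrapT => nl; move/eqP: H; apply; apply: big1 => l _.
    have -> : T l j = 0 by apply/eqP; apply: contrapT => /negP ?; apply: nl; exists l.
    by rewrite mulr0.
  have [C' [cC' iC']] := thurston_entry Hl.
  by exists (l, C').
have /choice[ch Hch] := child.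
pose s j := (ch j).1; pose K j := (ch j).2.
have cK j : is_component (f @^-1` gam j) (K j) by have [] := Hch j.
have iK j : isotopic A (K j) (gam (s j)) by have [] := Hch j.
pose w j := sheet_weight f (K j) (gam j).
have Tw i j : T i j = if i == s j then w j else 0.
  case: eqVneq => [->|ij].
    rewrite /T mxE (_ : [set C' | _] = [set K j]) ?fsbig_set1 //.
    apply/seteqP; split => [C' [cC' iC']|_ ->]; last by split.
    exact: uniq cC' (cK j) iC' (iK j).
  (* A second nonzero entry in column [j] would come from the same component [K j], making two
     distinct curves of the multicurve isotopic. *)
  apply/eqP; apply: contraT => /thurston_entry[C' [cC' iC']].
  have [_] := mg.2 _ _ ij; case.
  have e := uniq _ _ _ _ _ cC' (cK j) iC' (iK j).
  by apply: isotopic_trans (iK j); rewrite -e; exact: isotopic_sym.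
have pw k i j : (T ^+ k) i j != 0 -> i = iter k s j.
  elim: k i => [|k IH] i.
    by rewrite expr0 mxE; case: (eqVneq i j) => // _; rewrite mulr0n eqxx.
  rewrite exprS -mulmxE mxE => H.
  have [l] : exists l, T i l * (T ^+ k) l j != 0.
    apply: contrapT => nl; move/eqP: H; apply; apply: big1 => l _.
    by apply/eqP; apply: contrapT => /negP ?; apply: nl; exists l.
  rewrite mulf_eq0 negb_or Tw => /andP[il /IH el].
  by case: (eqVneq i (s l)) il => [-> _|_]; [rewrite /= -el|rewrite eqxx].
have orb i j : exists2 k, (0 < k)%N & i = iter k s j.
  by have [k k0 /lt0r_neq0/pw] := irr i j; exists k.
(* The nonzero entry excludes the default degree 0, whose inverse is 0; the inverse of a positive
   integer is at most 1. *)
have w01 j : 0 < w j <= 1.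
  have [_ _] := Hch j; rewrite Tw eqxx /w /sheet_weight.
  case: (cover_degree _ _ _) => [|d _]; first by rewrite invr0 eqxx.
  by rewrite invr_gt0 ltr0n /= invf_le1 ?ltr0n // ler1n.
have w1 j : w j = 1.
  apply/eqP; rewrite eq_le; have /andP[_ ->] := w01 j => /=; rewrite leNgt; apply/negP => wj.
  move: rad; rewrite leNgt => /negP; apply.
  exact: spectral_radius_weighted_permutation Tw orb w01 wj.
have [p Hp] := cyclic_order j0 orb.
split.
- exact: leq_ltn_trans (ltn_ord j0).
- exact: mg.1.
- exists p => i; exists (K (p i)); split => //; first by rewrite Hp.
  apply: cover_degree1_homeo => //; first by case: (mg.1 (p i)).
  have /eqP := w1 (p i); rewrite /w /sheet_weight invr_eq1.
  by rewrite pnatr_eq1 => /eqP.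
Qed.

End Levy.

Lemma finite_max (R : realType) (S : set R) x : finite_set S -> S x ->
  exists2 y, S y & forall z, S z -> z <= y.
Proof.
move=> /finite_seqP[s ->] /=; elim: s x => // a s IH x _.
case: s IH => [|b s] IH.
  by exists a => [|z] /=; rewrite ?inE ?mem_head // => /eqP ->.
have [|y ys ym] := IH b; first exact: mem_head.
have [ay|ya] := lerP a y.
  exists y; first by rewrite /= inE ys orbT.
  by move=> z /=; rewrite inE => /predU1P[->//|]; exact: ym.
exists a; first exact: mem_head.
move=> z /=; rewrite inE => /predU1P[->//|/ym zy]; exact: le_trans (ltW ya).
Qed.

Lemma finite_min (R : realType) (S : set R) x : finite_set S -> S x ->
  exists2 y, S y & forall z, S z -> y <= z.
Proof.
move=> fS Sx.
have fN : finite_set (-%R @` S) by exact: finite_image.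
have [_ [y Sy <-] H] := finite_max fN (ex_intro2 _ _ x Sx erefl).
by exists y => // z Sz; rewrite -lerN2; apply: H; exists z.
Qed.

Lemma finite_inj_image (T U : Type) (h : T -> U) (S : set T) :
  {in S &, injective h} -> finite_set (h @` S) -> finite_set S.
Proof.
move=> hinj fin; have [[x0 Sx0]|nS] := pselect (S !=set0); last first.
  suff -> : S = set0 by exact: finite_set0.
  by rewrite -subset0 => x Sx; apply: nS; exists x.
have /choice[k kP] : forall y, exists x, (h @` S) y -> S x /\ h x = y.
  move=> y; have [[x Sx <-]|nx] := pselect ((h @` S) y); first by exists x.
  by exists x0.
apply: sub_finite_set (finite_image k fin) => x Sx.
have [|Sk hk] := kP (h x); first by exists x.
by exists (h x); [exists x|apply: hinj => //; exact/mem_set].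
Qed.

Lemma compact_separated (R : realType) (X : pseudoMetricType R) (K L : set X) :
  compact K -> closed L -> K `&` L = set0 ->
  exists2 eps : R, 0 < eps & forall x y, K x -> L y -> ~ ball x eps y.
Proof.
move=> cK cL KL.
suff [r r0 rP] : exists2 r : R, 0 < r & forall x, K x -> forall y, L y -> ~ ball x r y.
  by exists r => // x y /rP; exact.
apply: compact_uniform => // x Kx.
have /nbhs_ballP[d /= d0 dP] : nbhs x (~` L).
  by apply: open_nbhs_nbhs; split;
    [rewrite openC|move=> Lx; rewrite -[False]/(set0 x) -KL].
exists (d / 2); first by rewrite divr_gt0.
move=> x' r xx' /andP[r0 rd] y Ly x'y; apply: (dP y) Ly.
by apply: (@ball_split _ _ x') => //; apply: le_ball x'y; exact: ltW.
Qed.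

(** * The Markov partition of the graph *)

Section Arc.
Variables (R : realType) (X : pseudoMetricType R) (V : set X) (e : R -> X).
Hypothesis hX : hausdorff_space X.
Hypothesis ce : continuous e.
Hypothesis e0 : V (e 0).
Hypothesis e1 : V (e 1).
Hypothesis einj : forall s t, 0 < s < 1 -> 0 < t < 1 -> e s = e t -> s = t.
Hypothesis eint : forall t, 0 < t < 1 -> ~ V (e t).

Lemma arc_param s t : 0 < s < 1 -> 0 <= t <= 1 -> e s = e t -> s = t.
Proof.
move=> s01 /andP[]; rewrite le_eqVlt => /predU1P[<- _|t0].
  by move=> e'; case: (eint s01); rewrite e'.
rewrite le_eqVlt => /predU1P[->|t1]; first by move=> e'; case: (eint s01); rewrite e'.
by apply: einj => //; rewrite t0.
Qed.

Lemma arc_closed a b : closed (e @` `[a, b]%classic).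
Proof.
apply: compact_closed => //; apply: continuous_compact.
  exact: continuous_subspaceT.
exact: segment_compact.
Qed.

(** The edge may be a loop, so its inverse is considered at interior parameters only; the image of
    the parameters far from [t0] is compact and misses [e t0]. *)
Lemma arc_param_continuous t0 (h : R) : 0 < t0 < 1 -> 0 < h ->
  \forall x \near e t0, forall t, 0 <= t <= 1 -> e t = x -> `|t0 - t| < h.
Proof.
move=> t01 h0.
pose K := `[0, t0 - h]%classic `|` `[t0 + h, 1]%classic.
have cK : closed (e @` K) by rewrite image_setU; apply: closedU; exact: arc_closed.
have : nbhs (e t0) (~` (e @` K)).
  apply: open_nbhs_nbhs; split; first by rewrite openC.
  move=> [t Kt] /esym et; have t01' : 0 <= t <= 1.
    case/andP: t01 => ? ?; case: Kt => /=; rewrite in_itv /= => /andP[? ?];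
      apply/andP; split; lra.
  have e' := arc_param t01 t01' et.
  by case: Kt => /=; rewrite in_itv /= -e' => /andP[? ?]; lra.
apply: filterS => x nK t /andP[t0' t1] et; rewrite ltr_norml.
apply/andP; split; rewrite ltNge; apply/negP => H; apply: nK; exists t => //.
  by right; rewrite /= in_itv /= t1 andbT; lra.
by left; rewrite /= in_itv /= t0' /=; lra.
Qed.

Lemma connected_arc_convex (Z : set X) t1 t2 t3 : connected Z ->
  (forall z, Z z -> exists2 t, 0 < t < 1 & e t = z) ->
  0 < t1 -> t1 < t2 -> t2 < t3 -> t3 < 1 -> Z (e t1) -> Z (e t3) -> Z (e t2).
Proof.
move=> cZ Ze t10 t12 t23 t31 Z1 Z3; apply: contrapT => Z2.
pose B := Z `&` e @` `[0, t2]%classic.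
have BE : B = Z `&` ~` (e @` `[t2, 1]%classic).
  apply/seteqP; split => z [Zz]; have [t /andP[t0 t1'] et] := Ze _ Zz.
    move=> [s /=]; rewrite in_itv /= => /andP[s0 s2] es; split => // -[u /=].
    rewrite in_itv /= => /andP[u2 u1] eu; apply: Z2.
    have ts : t = s by apply: arc_param; rewrite ?t0 ?s0 //=; [lra|rewrite et es].
    have tu : t = u by apply: arc_param; rewrite ?t0 ?u1 ?andbT //=; [lra|rewrite et eu].
    have -> : t2 = t by lra.
    by rewrite et.
  move=> H; split => //; exists t => //=; rewrite in_itv /= (ltW t0) /= leNgt.
  by apply/negP => tt2; apply: H; exists t => //=; rewrite in_itv /= !ltW.
have : B = Z.
  apply: cZ.
  - by exists (e t1); split => //; exists t1 => //=; rewrite in_itv /= !ltW.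
  - by exists (~` (e @` `[t2, 1]%classic)) => //; rewrite openC; exact: arc_closed.
  - by exists (e @` `[0, t2]%classic) => //; exact: arc_closed.
move=> BZ; move: Z3; rewrite -BZ => -[_ [s /=]]; rewrite in_itv /= => /andP[s0 s2] es.
have : t3 = s by apply: arc_param => //; rewrite ?s0 /=; [apply/andP; split; lra|lra].
by move=> ?; lra.
Qed.

Lemma arc_connected a b : a < b -> connected (e @` `]a, b[%classic).
Proof.
move=> ab; apply: connected_continuous_connected; last exact: continuous_subspaceT.
by apply/connected_intervalP; exact: interval_is_interval.
Qed.

End Arc.

Section Graph.
Variables (R : realType) (X : pseudoMetricType R) (f : X -> X) (V G : set X)
  (m : nat) (e : 'I_m -> R -> X).
Hypothesis hX : hausdorff_space X.
Hypothesis cf : continuous f.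
Hypothesis fib : forall y, finite_set (f @^-1` [set y]).
Hypothesis finV : finite_set V.
Hypothesis fV : forall x, V x -> V (f x).
Hypothesis fG : forall x, G x -> G (f x).
Hypothesis ce : forall i, continuous (e i).
Hypothesis e0 : forall i, V (e i 0).
Hypothesis e1 : forall i, V (e i 1).
Hypothesis einj : forall i s t, 0 < s < 1 -> 0 < t < 1 -> e i s = e i t -> s = t.
Hypothesis eint : forall i t, 0 < t < 1 -> ~ V (e i t).
Hypothesis edisj : forall i j s t, 0 < s < 1 -> 0 < t < 1 -> e i s = e j t -> i = j.
Hypothesis GE : forall x, G x <-> V x \/ exists i t, 0 < t < 1 /\ e i t = x.
Hypothesis mk : forall I, is_component (G `\` f @^-1` V) I ->
    (exists c, forall x, I x -> f x = c) \/ homeo_between I (f @` I) f.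

Definition marks : set X := [set x | G x /\ V (f x)].

Definition arc_piece i a b : Prop := [/\ 0 <= a, a < b, b <= 1, marks (e i a) /\ marks (e i b) &
  forall t, a < t < b -> ~ marks (e i t)].

(** Marked points and open arcs between consecutive ones. Leaving the end points out makes the
    pieces disjoint, so every point of [G] has exactly one itinerary. *)
Definition piece (p : set X) : Prop :=
  (exists2 v, marks v & p = [set v]) \/
  (exists i a b, arc_piece i a b /\ p = e i @` `]a, b[%classic).

Lemma sub_marks v : V v -> marks v.
Proof. by move=> Vv; split; [apply/GE; left|exact: fV]. Qed.

Lemma arc_piece_param i a b t : arc_piece i a b -> a < t < b -> 0 < t < 1.
Proof. by case=> a0 ab b1 _ _ /andP[? ?]; apply/andP; split; lra. Qed.

Lemma edge_eq i j s t : 0 < s < 1 -> 0 < t < 1 -> e i s = e j t -> i = j /\ s = t.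
Proof. by move=> s01 t01 ee; have ij := edisj s01 t01 ee; split => //; subst j; exact: einj ee. Qed.

Lemma edge_eq_closed i j s t : 0 < s < 1 -> 0 <= t <= 1 -> e i s = e j t -> i = j /\ s = t.
Proof.
move=> s01 /andP[]; rewrite le_eqVlt => /predU1P[<- _|t0].
  by move=> e'; case: (eint s01 (i := i)); rewrite e'.
rewrite le_eqVlt => /predU1P[->|t1]; first by move=> e'; case: (eint s01 (i := i)); rewrite e'.
by apply: edge_eq => //; rewrite t0.
Qed.

Lemma piece_sub p : piece p -> p `<=` G.
Proof.
move=> [[v [Gv _] -> x ->//]|[i [a [b [ap ->]]]] _ [t /= + <-]].
rewrite in_itv /= => /(arc_piece_param ap) t01.
by apply/GE; right; exists i, t.
Qed.

Lemma piece_disjoint p q x : piece p -> piece q -> p x -> q x -> p = q.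
Proof.
have aux v i a b : marks v -> arc_piece i a b -> ~ (e i @` `]a, b[%classic) v.
  by move=> Mv [_ _ _ _ nM] [t /=]; rewrite in_itv /= => /nM nt ev; apply: nt; rewrite ev.
move=> [[v Mv ->]|[i [a [b [ap ->]]]]] [[v' Mv' ->]|[j [a' [b' [ap' ->]]]]] //.
- by move=> -> ->.
- by move=> -> /(aux _ _ _ _ Mv ap').
- by move=> + xv; rewrite xv => /(aux _ _ _ _ Mv' ap).
- move=> [s /=]; rewrite in_itv /= => sab <- [t /=]; rewrite in_itv /= => tab est.
  have [ij st] := edge_eq (arc_piece_param ap' tab) (arc_piece_param ap sab) est.
  subst j; subst t; case: ap ap' => a0 ab b1 [Ma Mb] nM [a0' ab' b1' [Ma' Mb'] nM'].
  case/andP: sab => ? ?; case/andP: tab => ? ?.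
  have -> : a = a'.
    case: (ltgtP a a') => // H; [case: (nM a')|case: (nM' a)] => //; apply/andP; split; lra.
  have -> // : b = b'.
    case: (ltgtP b b') => // H; [case: (nM' b)|case: (nM b')] => //; apply/andP; split; lra.
Qed.

Lemma finite_marks : finite_set marks.
Proof.
apply: (@sub_finite_set _ _ (\bigcup_(v in V) f @^-1` [set v])).
  by move=> x [_ Vx]; exists (f x).
by apply: bigcup_finite => // v _; exact: fib.
Qed.

Definition params i : set R := [set t | 0 <= t <= 1 /\ marks (e i t)].

Lemma finite_params i : finite_set (params i).
Proof.
have fin1 : finite_set [set t | 0 < t < 1 /\ marks (e i t)].
  apply: (@finite_inj_image _ _ (e i)).
    by move=> s t /set_mem[s01 _] /set_mem[t01 _]; exact: einj.
  by apply: sub_finite_set finite_marks => _ [t [_ ?] <-].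
apply: (@sub_finite_set _ _ ([set 0] `|` [set 1] `|` [set t | 0 < t < 1 /\ marks (e i t)])).
  move=> t [/andP[]]; rewrite le_eqVlt => /predU1P[<-|t0]; first by left; left.
  rewrite le_eqVlt => /predU1P[->|t1] M; first by left; right.
  by right; rewrite /= t0.
by rewrite !finite_setU.
Qed.

Lemma finite_pieces : finite_set piece.
Proof.
apply: (@sub_finite_set _ _ ((fun v : X => [set v]) @` marks `|`
    \bigcup_(i in [set: 'I_m]) (fun ab : R * R => e i @` `]ab.1, ab.2[%classic) @`
      (params i `*` params i))).
  move=> p [[v Mv ->]|[i [a [b [[a0 ab b1 [Ma Mb] _] ->]]]]]; first by left; exists v.
  right; exists i => //; exists (a, b) => //; split; split => //=; apply/andP; split; lra.
rewrite finite_setU; split; first by apply: finite_image; exact: finite_marks.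
apply: bigcup_finite => // i _; apply: finite_image.
by apply: finite_setX; exact: finite_params.
Qed.

Lemma piece_cover x : G x -> exists2 p, piece p & p x.
Proof.
move=> Gx; have [Mx|nM] := pselect (marks x); first by exists [set x] => //; left; exists x.
have [/sub_marks//|[i [t [/andP[t0 t1] et]]]] := (GE x).1 Gx.
have fS P : finite_set (params i `&` P).
  by apply: sub_finite_set (finite_params i) => s [].
have p0 : params i 0 by split; [rewrite lexx ler01|exact: sub_marks].
have p1 : params i 1 by split; [rewrite lexx ler01|exact: sub_marks].
have [a [[/andP[a0 a1] Ma] /= at_] amax] := @finite_max _ _ 0 (fS [set s | s < t]) (conj p0 t0).
have [b [[/andP[b0 b1] Mb] /= tb] bmin] := @finite_min _ _ 1 (fS [set s | t < s]) (conj p1 t1).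
exists (e i @` `]a, b[%classic); last by exists t => //=; rewrite in_itv /= at_.
right; exists i, a, b; split => //; split => //; first exact: lt_trans tb.
move=> s /andP[as_ sb] Ms.
have ps : params i s by split => //; apply/andP; split; lra.
case: (ltgtP s t) => st.
- by have := amax s (conj ps st); rewrite leNgt as_.
- by have := bmin s (conj ps st); rewrite leNgt sb.
- by apply: nM; rewrite -et -st.
Qed.

Lemma piece_connected p : piece p -> connected p.
Proof.
move=> [[v _ ->]|[i [a [b [[_ ab _ _ _] ->]]]]]; first exact: connected1.
exact: arc_connected.
Qed.

(** An arc piece lies in one component of [G] minus the preimage of [V], where the Markov condition
    applies. The continuous inverse is what pulls back connected sets and paths. *)
Lemma piece_inverse q : piece q -> exists2 g : X -> X,
  {within f @` q, continuous g} & forall x, q x -> g (f x) = x.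
Proof.
move=> [[v Mv ->]|[i [a [b [ap ->]]]]].
  exists (fun=> v); last by move=> x ->.
  by apply: continuous_subspaceT => x; exact: cvg_cst.
have [a0 ab b1 _ nM] := ap.
set p := e i @` _.
have pG : p `<=` G `\` f @^-1` V.
  move=> x px; have Gx : G x by apply: (@piece_sub p) => //; right; exists i, a, b.
  split => // Vfx; have Mx : marks x by [].
  by move: px => [t /=]; rewrite in_itv /= => tab et; apply: (nM t tab); rewrite et.
pose x0 := e i ((a + b) / 2).
have px0 : p x0 by exists ((a + b) / 2) => //=; rewrite in_itv /=; apply/andP; split; lra.
pose I := connected_component (G `\` f @^-1` V) x0.
have pI : p `<=` I.
  by apply: connected_component_max => //; exact: arc_connected.
have cI : is_component (G `\` f @^-1` V) I by exists x0 => //; exact: pG.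
have [[c Hc]|[g [_ cg _ _ [gK _]]]] := mk cI.
  (* [f] cannot be constant here: its fibres are finite and the arc is infinite. *)
  exfalso.
  have : finite_set p by apply: sub_finite_set (fib c) => x /pI /Hc.
  move=> /finite_inj_image fin.
  have {}fin : finite_set `]a, b[%classic.
    apply: fin => s t /set_mem /=; rewrite in_itv /= => sab /set_mem /=.
    by rewrite in_itv /= => tab; apply: einj; exact: arc_piece_param ap _.
  have [|y] := @finite_max _ _ ((a + b) / 2) fin.
    by rewrite /= in_itv /=; apply/andP; split; lra.
  rewrite /= in_itv /= => /andP[ay yb] /(_ ((y + b) / 2)).
  rewrite /= in_itv /=; have -> : a < (y + b) / 2 < b by apply/andP; split; lra.
  by move=> /(_ isT); lra.
exists g; last by move=> x /pI; exact: gK.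
by apply: continuous_subspaceW cg; exact: image_subset.
Qed.

Lemma piece_inj p x y : piece p -> p x -> p y -> f x = f y -> x = y.
Proof. by move=> /piece_inverse[g _ gK] px py e'; rewrite -(gK x) // e' gK. Qed.

(** The image avoids [V], so finitely many closed edges split the parameter interval into disjoint
    relatively closed, hence relatively open, sets; connectedness leaves one. *)
Lemma arc_edge i a b : arc_piece i a b -> exists l, forall s, a < s < b ->
  exists2 t, 0 < t < 1 & e l t = f (e i s).
Proof.
move=> ap; have [a0 ab b1 _ nM] := ap.
have GV s : a < s < b -> exists l t, 0 < t < 1 /\ e l t = f (e i s).
  move=> sab; have Gs : G (e i s).
    by apply/GE; right; exists i, s; split => //; exact: arc_piece_param ap _.
  have /GE[Vs|//] := fG Gs; by case: (nM s sab).
have ch : continuous (f \o e i) by move=> s; apply: continuous_comp; [exact: ce|exact: cf].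
have smid : a < (a + b) / 2 < b by apply/andP; split; lra.
have [l [t0 [t01 et0]]] := GV _ smid; exists l.
pose E k := (f \o e i) @^-1` (e k @` `[0, 1]%classic).
have cE k : closed (E k) by apply: closed_comp => [s _|]; [exact: ch|exact: arc_closed].
pose B := `]a, b[%classic `&` E l.
have in01 t : 0 < t < 1 -> `[0, 1]%classic t by rewrite /= in_itv /= => /andP[/ltW-> /ltW->].
have BE : B = `]a, b[%classic `&` ~` (\bigcup_(k in [set k | k != l]) E k).
  apply/seteqP; split => s [/[dup] sab /=]; rewrite in_itv /= => /GV[k [t [t01' et]]].
    move=> [u /=]; rewrite in_itv /= => u01 eu; split => // -[k' kl [v /=]].
    rewrite in_itv /= => v01 ev.
    have [kk' _] := edge_eq_closed t01' v01 (etrans et (esym ev)).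
    have [kl' _] := edge_eq_closed t01' u01 (etrans et (esym eu)).
    by move: kl; rewrite /= -kk' kl' eqxx.
  move=> H; split => //; suff <- : k = l by exists t => //; exact: in01.
  by apply/eqP; apply: contrapT => /negP kl; apply: H; exists k => //; exists t => //; exact: in01.
have BT : B = `]a, b[%classic.
  have : connected `]a, b[%classic by apply/connected_intervalP; exact: interval_is_interval.
  apply.
  - exists ((a + b) / 2); split; rewrite /= ?in_itv //.
    by exists t0 => //; exact: in01.
  - exists (~` (\bigcup_(k in [set k | k != l]) E k)) => //.
    by rewrite openC; apply: closed_bigcup => //; exact: finite_finset.
  - by exists (E l).
move=> s sab; have [k [t [t01' et]]] := GV _ sab.
have : B s by rewrite BT /= in_itv.
move=> [_ [u /=]]; rewrite in_itv /= => u01 eu.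
have [<- _] := edge_eq_closed t01' u01 (etrans et (esym eu)).
by exists t.
Qed.

(* The image of an arc piece is relatively closed in its edge because the ends
   go to vertices, and relatively open because it is parametrised by a strictly
   monotone function. *)
Lemma arc_image i a b : arc_piece i a b ->
  exists l, f @` (e i @` `]a, b[%classic) = e l @` `]0, 1[%classic.
Proof.
move=> ap; have [a0 ab b1 [[_ Va] [_ Vb]] nM] := ap.
have [l Hl] := arc_edge ap; exists l.
have pP : piece (e i @` `]a, b[%classic) by right; exists i, a, b.
have ch : continuous (f \o e i) by move=> s; apply: continuous_comp; [exact: ce|exact: cf].
have /choice[tau tauP] : forall s, exists t, a < s < b -> 0 < t < 1 /\ e l t = f (e i s).
  move=> s; have [sab|nsab] := boolP (a < s < b); last by exists 0.
  by have [t ? ?] := Hl _ sab; exists t.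
have tau_inj : {in `]a, b[ &, injective tau}.
  move=> s s'; rewrite !in_itv /= => sab sab' e'.
  have [_ es] := tauP s sab; have [_ es'] := tauP s' sab'.
  apply: (@einj i); [exact: arc_piece_param ap _|exact: arc_piece_param ap _|].
  apply: (piece_inj pP); [by exists s; rewrite //= in_itv|by exists s'; rewrite //= in_itv|].
  by rewrite -es -es' e'.
have tau_cont : {within [set` `]a, b[], continuous tau}.
  rewrite continuous_open_subspace; last exact: interval_open.
  move=> s /set_mem /=; rewrite in_itv /= => sab.
  have [s01 es] := tauP s sab.
  apply/cvgrPdist_lt => h h0.
  have := arc_param_continuous hX (@ce l) (@e0 l) (@e1 l) (@einj l) (@eint l) s01 h0.
  rewrite es => /(ch s); rewrite nbhs_simpl /= => nP.
  near=> s'; have sab' : a < s' < b.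
    apply/andP; split; near: s'; [apply: lt_nbhsr|apply: lt_nbhsl]; by case/andP: sab.
  have [/andP[t0 t1] es'] := tauP s' sab'.
  have : forall t, 0 <= t <= 1 -> e l t = f (e i s') -> `|tau s - t| < h by near: s'.
  by apply => //; rewrite !ltW.
have mono := itv_continuous_inj_mono tau_cont tau_inj.
have between s1 s s2 : a < s1 -> s1 < s -> s < s2 -> s2 < b ->
    Num.min (tau s1) (tau s2) < tau s < Num.max (tau s1) (tau s2).
  move=> as1 s1s ss2 s2b.
  have [i1 i2 i3] : [/\ s1 \in `]a, b[, s \in `]a, b[ & s2 \in `]a, b[].
    by rewrite !in_itv /=; split; apply/andP; split; lra.
  case: mono => mn.
    have ? := mn _ _ i1 i2 s1s; have ? := mn _ _ i2 i3 ss2; rewrite gt_min lt_max.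
    by apply/andP; split; apply/orP; [left|right].
  have ? := mn _ _ i2 i1 s1s; have ? := mn _ _ i3 i2 ss2; rewrite gt_min lt_max.
  by apply/andP; split; apply/orP; [right|left].
pose J := tau @` `]a, b[%classic.
have cJ : connected J.
  apply: connected_continuous_connected => //.
  by apply/connected_intervalP; exact: interval_is_interval.
have iJ : is_interval J by apply/connected_intervalP.
(* The ends [a] and [b] map into [V], so adding them to the arc adds nothing to its image inside the
   open edge; hence [J] is relatively closed. *)
have JE u : 0 < u < 1 -> J u <-> (e l @^-1` ((f \o e i) @` `[a, b]%classic)) u.
  move=> u01; split => [[s /=]|[s /=]]; rewrite in_itv /= => sab.
    move=> <-; have [_ es] := tauP s sab; exists s => //=.
    by rewrite in_itv /=; case/andP: sab => /ltW-> /ltW->.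
  move=> es; have sab' : a < s < b.
    move: sab => /andP[]; rewrite le_eqVlt => /predU1P[as_ _|as_].
      by case: (eint u01 (i := l)); rewrite -es -as_.
    rewrite le_eqVlt => /predU1P[sb|->]; last by rewrite as_.
    by case: (eint u01 (i := l)); rewrite -es sb.
  have [t01 et] := tauP s sab'; exists s; rewrite /= ?in_itv //.
  by apply: (@einj l) => //; rewrite et -es.
have JT : J = `]0, 1[%classic.
  have J01 : J `<=` `]0, 1[%classic.
    by move=> u [s /=]; rewrite in_itv /= => /tauP[] ? _ <-; rewrite /= in_itv.
  have : connected (`]0, 1[%classic : set R).
    by apply/connected_intervalP; exact: interval_is_interval.
  apply.
  - by exists (tau ((a + b) / 2)), ((a + b) / 2) => //=; rewrite in_itv /=; apply/andP; split; lra.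
  - exists (J°); first exact: open_interior.
    apply/seteqP; split => u; last by move=> [_ /interior_subset].
    move=> Ju; split; first exact: J01.
    case: Ju => s /=; rewrite in_itv /= => /andP[as_ sb] <-.
    have := between ((a + s) / 2) s ((s + b) / 2).
    move/(_ ltac:(lra) ltac:(lra) ltac:(lra) ltac:(lra)).
    set s1 := (a + s) / 2; set s2 := (s + b) / 2; move=> /andP[lo hi].
    have J1 : J (tau s1) by exists s1 => //=; rewrite in_itv /= /s1; apply/andP; split; lra.
    have J2 : J (tau s2) by exists s2 => //=; rewrite in_itv /= /s2; apply/andP; split; lra.
    have Jmin : J (Num.min (tau s1) (tau s2)) by rewrite minElt; case: ifP.
    have Jmax : J (Num.max (tau s1) (tau s2)) by rewrite maxElt; case: ifP.
    rewrite /interior; near=> v; apply: (iJ _ _ Jmin Jmax); apply/andP; split; apply/ltW.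
      by near: v; exact: lt_nbhsr.
    by near: v; exact: lt_nbhsl.
  - exists (e l @^-1` ((f \o e i) @` `[a, b]%classic)).
      apply: closed_comp => [u _|]; first exact: ce.
      exact: arc_closed.
    apply/seteqP; split => u.
      by move=> /[dup] /J01 /[dup] u01 /=; rewrite in_itv /= => /JE H /H.
    by move=> [/= + Eu]; rewrite in_itv /= => /JE H; apply/H.
apply/seteqP; split => x.
  move=> [_ [s sab <-] <-]; rewrite /= in_itv /= in sab; have [t01 et] := tauP s sab.
  by exists (tau s) => //=; rewrite in_itv.
move=> [u u01 <-]; move: u01; rewrite -JT => -[s sab <-].
have sab' := sab; rewrite /= in_itv /= in sab'; have [_ ->] := tauP s sab'.
by exists (e i s) => //; exists s.
Unshelve. all: end_near. Qed.

(** A marked point maps into [V], which an arc piece misses. An arc piece covers a whole open edge,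
    hence each arc piece that its image meets. *)
Lemma piece_markov p q x : piece p -> piece q -> p x -> q (f x) -> q `<=` f @` p.
Proof.
move=> pp qq px qx y qy.
have [[v Mv qE]|[j [a' [b' [ap' qE]]]]] := qq.
  by exists x => //; move: qx qy; rewrite qE => -> ->.
have nVq z : q z -> ~ V z.
  rewrite qE => -[t /=]; rewrite in_itv /= => /(arc_piece_param ap') t01 <-; exact: eint.
have [[v Mv pE]|[i [a [b [ap pE]]]]] := pp.
  by move: px; rewrite pE => xv; case: (nVq _ qx); rewrite xv; case: Mv.
have [l fE] := arc_image ap.
have : (f @` p) (f x) by exists x.
rewrite pE fE => -[t /=]; rewrite in_itv /= => t01 et.
move: qx qy; rewrite qE => -[s /=]; rewrite in_itv /= => /(arc_piece_param ap') s01 es.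
have [-> _] := edge_eq t01 s01 (etrans et (esym es)).
move=> [u /=]; rewrite in_itv /= => /(arc_piece_param ap') u01 <-.
by exists u => //=; rewrite in_itv.
Qed.

(* Ordering the six subsets along the arc, the second and the fifth are kept
   apart by the first, third, fourth and sixth. *)
Lemma piece_separation (I : finType) (Z : I -> set X) p : (5 < #|I|)%N -> piece p ->
  (forall k, Z k `<=` p) -> (forall k, connected (Z k)) -> (forall k, Z k !=set0) ->
  (forall k l x, Z k x -> Z l x -> k = l) ->
  exists k l, exists2 eps : R, 0 < eps & forall x y, Z k x -> Z l y -> ~ ball x eps y.
Proof.
move=> I5 pp Zp Zc Z0 Zd.
case: pp => [[v Mv pE]|[i [a [b [ap pE]]]]].
  exfalso; have /card_gt1P[k [l [_ _ /eqP kl]]] : (1 < #|I|)%N by apply: leq_trans I5.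
  apply: kl; have [x Zx] := Z0 k; have [y Zy] := Z0 l.
  have := Zp _ _ Zx; have := Zp _ _ Zy; rewrite pE => /= yv xv.
  by apply: (Zd k l v); [rewrite -xv|rewrite -yv].
have [a0 ab b1 _ nM] := ap.
have /choice[t tP] : forall k, exists t, a < t < b /\ Z k (e i t).
  move=> k; have [x Zx] := Z0 k; have := Zp _ _ Zx; rewrite pE => -[t /=].
  by rewrite in_itv /= => tab xt; exists t; rewrite xt.
have t_inj : injective t.
  by move=> k l kl; apply: (Zd k l (e i (t k))); [|rewrite kl]; exact: (tP _).2.
have /card_gt0P[k0 _] : (0 < #|I|)%N by apply: leq_trans I5.
pose s := sort (relpre t <=%R) (enum I).
have ss : size s = #|I| by rewrite size_sort -cardE.
have lt_t x y : (x < y)%N -> (y < 6)%N -> t (nth k0 s x) < t (nth k0 s y).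
  move=> xy y6; have ys : (y < size s)%N by rewrite ss; exact: leq_trans I5.
  have xs := ltn_trans xy ys.
  rewrite lt_neqAle; apply/andP; split.
    rewrite (inj_eq t_inj) nth_uniq // ?neq_ltn ?xy //.
    by rewrite sort_uniq enum_uniq.
  have tot : total (relpre t <=%R) by move=> u v; exact: le_total.
  have tr : transitive (relpre t <=%R) by move=> u v w; exact: le_trans.
  exact: (sorted_ltn_nth tr k0 (sort_sorted tot (enum I))).
have cvx x z : (x.+2 < 6)%N -> Z (nth k0 s x.+1) z ->
    (e i @` `[t (nth k0 s x), t (nth k0 s x.+2)]%classic) z.
  move=> x6 Zz; have := Zp _ _ Zz; rewrite pE => -[u /=]; rewrite in_itv /= => uab uz.
  have t1 := lt_t x x.+1 (ltnSn _) (ltn_trans (ltnSn _) x6).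
  have t2 := lt_t x.+1 x.+2 (ltnSn _) x6.
  have sub y : Z (nth k0 s x.+1) y -> exists2 t, 0 < t < 1 & e i t = y.
    move=> /Zp; rewrite pE => -[w /=]; rewrite in_itv /= => /(arc_piece_param ap) w01 <-.
    by exists w.
  have apart y : (y < 6)%N -> Z (nth k0 s x.+1) (e i (t (nth k0 s y))) -> y = x.+1.
    move=> y6 /(Zd _ _ _ (tP (nth k0 s y)).2) /eqP.
    have us : uniq s by rewrite sort_uniq enum_uniq.
    have sz w : (w < 6)%N -> (w < size s)%N by move=> w6; rewrite ss; exact: leq_trans I5.
    by rewrite nth_uniq ?sz // => [/eqP //|]; exact: ltn_trans x6.
  have [ta tb] := andP (tP (nth k0 s x)).1; have [ta1 tb1] := andP (tP (nth k0 s x.+1)).1.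
  have [ta2 tb2] := andP (tP (nth k0 s x.+2)).1; have [ua ub] := andP uab.
  have mid := (tP (nth k0 s x.+1)).2.
  exists u => //=; rewrite in_itv /=; apply/andP; split; rewrite leNgt; apply/negP => H.
    suff /n_Sn : x = x.+1 by [].
    apply: apart; first exact: ltn_trans (ltnSn _) (ltn_trans (ltnSn _) x6).
    apply: (connected_arc_convex hX (@ce i) (@e0 i) (@e1 i) (@einj i) (@eint i)
      (Zc _) sub _ H t1) => //.
    + lra.
    + lra.
    + by rewrite uz.
  suff [/esym/n_Sn] : x.+2 = x.+1 by [].
  apply: apart; first exact: x6.
  apply: (connected_arc_convex hX (@ce i) (@e0 i) (@e1 i) (@einj i) (@eint i)
    (Zc _) sub _ t2 H) => //.
  + lra.
  + lra.
  + by rewrite uz.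
exists (nth k0 s 1), (nth k0 s 4).
have [|||eps eps0 H] := @compact_separated R X (e i @` `[t (nth k0 s 0), t (nth k0 s 2)]%classic)
  (e i @` `[t (nth k0 s 3), t (nth k0 s 5)]%classic).
- by apply: continuous_compact; [exact: continuous_subspaceT|exact: segment_compact].
- exact: arc_closed.
- rewrite -subset0 => _ [[u u02 <-] [v v35 /esym uv]].
  move: u02 v35; rewrite /= !in_itv /= => /andP[u0 u2] /andP[v3 v5].
  have t23 := lt_t 2%N 3%N isT isT.
  have [ta tb] := andP (tP (nth k0 s 0)).1; have [ta5 tb5] := andP (tP (nth k0 s 5)).1.
  have : u = v.
    apply: (arc_param (@e0 i) (@e1 i) (@einj i) (@eint i)) => //; apply/andP; split; lra.
  by move=> e'; have := lt_le_trans t23 (le_trans v3 _); rewrite -e' => /(_ _ u2); rewrite ltxx.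
exists eps => // x y /(cvx 0%N _ isT) Kx /(cvx 3%N _ isT) Ky; exact: H.
Qed.

End Graph.

(** * Horseshoes and entropy *)

Section Entropy.
Local Open Scope card_scope.
Variables (R : realType) (f : S2 R -> S2 R) (G : set (S2 R)).

(** Words of length [m] are realised by points that are pairwise separated during time [N * m], so a
    spanning set at half the gap has at least [2 ^ m] elements and the entropy is at least
    [ln 2 / N]. *)
Lemma horseshoe_entropy (p : set (S2 R)) N (K : bool -> set (S2 R)) (eps : R) :
  0 < eps -> (0 < N)%N -> p `<=` G -> p !=set0 -> (forall b, K b `<=` p) ->
  (forall b y, p y -> exists2 x, K b x & iter N f x = y) ->
  (forall x y, K false x -> K true y -> ~ ball x eps y) -> h_top f G <> 0%E.
Proof.
move=> e0 N0 pG [y0 py0] Kp Ksurj Ksep.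
have e20 : 0 < eps / 2 by rewrite divr_gt0.
(* The orbit is built backwards, from the last letter of the word to the first. *)
have orbit s : exists2 x, p x &
    forall l, (l < size s)%N -> K (nth false s l) (iter (N * l) f x).
  elim: s => [|b s [x' px' H]]; first by exists y0.
  have [x Kx fx] := Ksurj b x' px'; exists x; first exact: Kp Kx.
  case=> [_|l]; first by rewrite muln0.
  by rewrite ltnS /= mulnS addnC iterD fx; exact: H.
have count m M E : spanning f G (N * m) (eps / 2) E -> E #= `I_M -> (2 ^ m <= M)%N.
  move=> [EG Espan] /card_set_bijP[g [gE ginj _]].
  have /choice[x Hx] : forall s : m.-tuple bool, exists x, p x /\
      forall l, (l < size s)%N -> K (nth false s l) (iter (N * l) f x).
    by move=> s; have [x] := orbit s; exists x.
  have /choice[y Hy] : forall s : m.-tuple bool, exists y, E y /\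
      forall j, (j < N * m)%N -> ball (iter j f (x s)) (eps / 2) (iter j f y).
    by move=> s; have [|y] := Espan (x s); [exact/pG/(Hx s).1|exists y].
  have gM s : (g (y s) < M)%N by apply: gE; exact: (Hy s).1.
  have inj : injective (fun s => Ordinal (gM s)).
    move=> s s' [gs].
    have ys : y s = y s'.
      by apply: ginj gs; rewrite inE; [exact: (Hy s).1|exact: (Hy s').1].
    apply: val_inj; apply: (@eq_from_nth _ false); rewrite ?size_tuple // => l lm.
    have [_ /(_ l)] := Hx s; rewrite size_tuple => /(_ lm) Kl.
    have [_ /(_ l)] := Hx s'; rewrite size_tuple => /(_ lm) Kl'.
    have lN : (N * l < N * m)%N by rewrite ltn_pmul2l.
    have b1 := (Hy s).2 _ lN; have b2 := (Hy s').2 _ lN.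
    rewrite -ys in b2.
    case: (nth false s l) Kl => Kl; case: (nth false s' l) Kl' => Kl' //; exfalso.
      exact: Ksep Kl' Kl (ball_splitl b2 b1).
    exact: Ksep Kl Kl' (ball_splitl b1 b2).
  by have := leq_card _ inj; rewrite card_tuple card_bool card_ord.
set c : \bar R := (ln 2 / N%:R)%:E.
have c0 : (0 < c)%E by rewrite lte_fin divr_gt0 ?ln_gt0 ?ltr0n // ltr1n.
suff : (c <= h_top f G)%E by move=> ch h0; move: c0; rewrite ltNge -h0 ch.
apply: ereal_sup_ge.
eexists; first by exists (eps / 2).
rewrite limn_esup_lim; apply: lime_ge; first exact: is_cvg_esups.
near=> k.
(* For a lower bound on the upper limit, multiples of [N] suffice; [k.+1] keeps the length
   positive. *)
apply: ereal_sup_ge; eexists.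
  by exists (N * k.+1)%N => //=; rewrite (@leq_trans k.+1) ?leq_pmull.
apply: le_ereal_inf_tmp => _ [M [E sE EM] <-].
rewrite lee_fin ler_pdivrMr ?ltr0n // mulrAC ler_pdivlMr ?ltr0n ?muln_gt0 ?N0 //.
have := count _ _ _ sE EM.
set m := k.+1.
rewrite -(ler_nat R) natrX => M2.
rewrite natrM [leLHS]mulrCA mulrC ler_wpM2r //.
rewrite mulr_natr -lnXn ?ltr0n //.
have p2 : 0 < (2 : R) ^+ m by rewrite exprn_gt0.
by rewrite ler_ln ?posrE //; exact: lt_le_trans M2.
Unshelve. all: end_near. Qed.

End Entropy.

(** * Symbolic dynamics of the partition *)

Section MarkovPartition.
Variables (R : realType) (f : S2 R -> S2 R) (G : set (S2 R)) (T : finType)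
  (pc : T -> set (S2 R)).
Hypothesis pc_sub : forall u, pc u `<=` G.
Hypothesis pc_inj : forall u v x, pc u x -> pc v x -> u = v.
Hypothesis pc_nonempty : forall u, pc u !=set0.
Hypothesis pc_connected : forall u, connected (pc u).
Hypothesis pc_inverse : forall u, exists2 g : S2 R -> S2 R,
  {within f @` pc u, continuous g} & forall x, pc u x -> g (f x) = x.
Hypothesis pc_separation : forall (I : finType) (Z : I -> set (S2 R)) u,
  (5 < #|I|)%N ->
  (forall k, Z k `<=` pc u) -> (forall k, connected (Z k)) -> (forall k, Z k !=set0) ->
  (forall k l x, Z k x -> Z l x -> k = l) ->
  exists k l, exists2 eps : R, 0 < eps & forall x y, Z k x -> Z l y -> ~ ball x eps y.

Definition transition : rel T := [rel u v | `[< pc v `<=` f @` pc u >]].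

(** The cylinder of points that follow [w] for [n] steps and then land in [Z]. *)
Fixpoint pullback n (w : nat -> T) (Z : set (S2 R)) : set (S2 R) :=
  if n is n'.+1 then pc (w 0%N) `&` f @^-1` pullback n' (w \o succn) Z else Z.

Lemma walk_succ n w : walk transition n.+1 w -> walk transition n (w \o succn).
Proof. by move=> W i; exact: (W i.+1). Qed.

Lemma pullback_sub n w Z : Z `<=` pc (w n) -> pullback n w Z `<=` pc (w 0%N).
Proof. by case: n => [|n] //= _; exact: subIsetl. Qed.

Lemma pullback_end n w Z x : pullback n w Z x -> Z (iter n f x).
Proof.
elim: n w x => [|n IH] w x //= [_ /= /IH].
by rewrite -iterSr.
Qed.

Lemma pullback_itinerary n w Z x : Z `<=` pc (w n) -> pullback n w Z x ->
  forall i, (i <= n)%N -> pc (w i) (iter i f x).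
Proof.
elim: n w x => [|n IH] w x Zw /=.
  by move=> /Zw Zx i; rewrite leqn0 => /eqP ->.
by move=> [px /= fx] [|i] // ilt; rewrite iterSr; exact: (IH (w \o succn)).
Qed.

Lemma pullback_surj n w Z z : walk transition n w -> Z `<=` pc (w n) -> Z z ->
  exists2 x, pullback n w Z x & iter n f x = z.
Proof.
elim: n w => [|n IH] w W Zw Zz /=; first by exists z.
have [x px xz] := IH _ (walk_succ W) Zw Zz.
have /asboolP sub := W 0%N isT.
have [y py fy] := sub _ (pullback_sub (w := w \o succn) Zw px).
by exists y; [split => //=; rewrite fy|rewrite -iterS iterSr fy].
Qed.

(** Within one piece the preimage is the image under a continuous inverse branch, which preserves
    connectedness. *)
Lemma pullback_connected n w Z : walk transition n w -> Z `<=` pc (w n) -> connected Z ->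
  connected (pullback n w Z).
Proof.
elim: n w => [|n IH] w W Zw cZ //=.
have cP := IH _ (walk_succ W) Zw cZ.
have /asboolP sub := W 0%N isT.
have [g cg gK] := pc_inverse (w 0%N).
have subP : pullback n (w \o succn) Z `<=` f @` pc (w 0%N).
  exact: subset_trans (pullback_sub (w := w \o succn) Zw) sub.
suff -> : pc (w 0%N) `&` f @^-1` pullback n (w \o succn) Z = g @` pullback n (w \o succn) Z.
  apply: connected_continuous_connected => //; exact: continuous_subspaceW cg.
apply/seteqP; split => [x [px fx]|_ [y Py <-]]; first by exists (f x) => //; exact: gK.
by have [x px xy] := subP _ Py; rewrite -xy gK //; split => //=; rewrite xy.
Qed.

(** Two different loops at [u], concatenated three at a time, give eight disjoint connected subsets
    of the piece, each mapped onto it by the iterate of order [3 n]. More than five are needed to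
    find two at positive distance, and these form a horseshoe. *)
Lemma closed_walk_unique : h_top f G = 0%E -> forall n w w',
  walk transition n w -> walk transition n w' ->
  w 0%N = w n -> w' 0%N = w' n -> w 0%N = w' 0%N -> forall i, (i <= n)%N -> w i = w' i.
Proof.
move=> h0 n w w' W W' wn wn' ww' i0 i0n; apply: contrapT => ne.
have n0 : (0 < n)%N.
  rewrite lt0n; apply/negP => /eqP nE; apply: ne.
  have -> : i0 = 0%N by apply/eqP; rewrite -leqn0 -nE.
  exact: ww'.
set u := w 0%N in wn ww'.
pose wb (b : bool) := if b then w' else w.
pose pb b Z := pullback n (wb b) Z.
have Wb b : walk transition n (wb b) by case: b.
have wb0 b : wb b 0%N = u by case: b.
have wbn b : wb b n = u by case: b => //=; rewrite -wn'.
have pb_sub b Z : Z `<=` pc u -> pb b Z `<=` pc u.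
  by move=> Zu; rewrite -(wb0 b); apply: pullback_sub; rewrite wbn.
have pb_conn b Z : Z `<=` pc u -> connected Z -> connected (pb b Z).
  by move=> Zu; apply: pullback_connected => //; rewrite wbn.
have pb_surj b Z z : Z `<=` pc u -> Z z -> exists2 x, pb b Z x & iter n f x = z.
  by move=> Zu; apply: pullback_surj => //; rewrite wbn.
have pb_end b Z x : pb b Z x -> Z (iter n f x) by exact: pullback_end.
have pb_eq b b' Z Z' x : Z `<=` pc u -> Z' `<=` pc u -> pb b Z x -> pb b' Z' x -> b = b'.
  move=> Zu Z'u px px'.
  have Hb : pc (wb b i0) (iter i0 f x).
    by apply: (pullback_itinerary _ px) => //; rewrite wbn.
  have Hb' : pc (wb b' i0) (iter i0 f x).
    by apply: (pullback_itinerary _ px') => //; rewrite wbn.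
  by have := pc_inj Hb Hb'; case: b {px Hb}; case: b' {px' Hb'} => //= e'; case: ne.
pose D (k : bool * bool * bool) := pb k.1.1 (pb k.1.2 (pb k.2 (pc u))).
have D1 b : pb b (pc u) `<=` pc u by exact: pb_sub.
have D2 b c : pb b (pb c (pc u)) `<=` pc u by exact: pb_sub.
have D3 k : D k `<=` pc u by exact: pb_sub.
have Dsurj k z : pc u z -> exists2 x, D k x & iter (n + n + n) f x = z.
  move=> uz; have [x1 p1 e1] := pb_surj k.2 _ _ (fun _ => id) uz.
  have [x2 p2 e2] := pb_surj k.1.2 _ _ (D1 _) p1.
  have [x3 p3 e3] := pb_surj k.1.1 _ _ (D2 _ _) p2.
  by exists x3 => //; rewrite !iterD e3 e2.
have [||||k [l [eps eps0 sep]]] := pc_separation (Z := D) (u := u) _ D3.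
- by rewrite !card_prod card_bool.
- by move=> k; rewrite /D; apply: (pb_conn) => //; apply: (pb_conn) => //; apply: (pb_conn).
- by move=> k; have [z uz] := pc_nonempty u; have [x Dx _] := Dsurj k z uz; exists x.
- move=> [[b1 b2] b3] [[c1 c2] c3] x Dx Dx'.
  have e1 := pb_eq _ _ _ _ _ (D2 _ _) (D2 _ _) Dx Dx'.
  have {}Dx := pb_end _ _ _ Dx; have {}Dx' := pb_end _ _ _ Dx'.
  have e2 := pb_eq _ _ _ _ _ (D1 _) (D1 _) Dx Dx'.
  have {}Dx := pb_end _ _ _ Dx; have {}Dx' := pb_end _ _ _ Dx'.
  have e3 := pb_eq _ _ _ _ _ (fun _ => id) (fun _ => id) Dx Dx'.
  by move: e1 e2 e3 => /= -> -> ->.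
apply: (@horseshoe_entropy R f G (pc u) (n + n + n) (fun b => if b then D l else D k) eps) h0 => //.
- by rewrite !addn_gt0 n0.
- by case.
- by move=> b y uy; case: b; exact: Dsurj.
Qed.

End MarkovPartition.

(** * Counting preimage components that meet the graph *)

Section Segment.
Variable R : realType.

Definition segment_path (s t u : R) : R := s + clamp u * (t - s).

Lemma segment_path0 s t : segment_path s t 0 = s.
Proof. by rewrite /segment_path clamp0 mul0r addr0. Qed.

Lemma segment_path1 s t : segment_path s t 1 = t.
Proof. by rewrite /segment_path clamp1 mul1r addrC subrK. Qed.

Lemma segment_path_clamp s t u : segment_path s t (clamp u) = segment_path s t u.
Proof. by rewrite /segment_path clampK. Qed.

Lemma segment_path_continuous s t : continuous (segment_path s t).
Proof.
move=> u; apply: cvgD; first exact: cvg_cst.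
by apply: cvgM; [exact: continuous_clamp|exact: cvg_cst].
Qed.

Lemma segment_path_itv a b s t u : a < s < b -> a < t < b -> a < segment_path s t u < b.
Proof.
move=> /andP[as_ sb] /andP[at_ tb]; rewrite /segment_path.
have /andP[c0 c1] := clamp_itv u.
have H (x y z : R) : x < y -> x < z -> x < y + clamp u * (z - y).
  move=> xy xz; rewrite -subr_gt0.
  have -> : y + clamp u * (z - y) - x = (1 - clamp u) * (y - x) + clamp u * (z - x) by ring.
  have [cp|cn] := ltrP 0 (clamp u).
    by apply: ltr_wpDl; [rewrite mulr_ge0 // subr_ge0 // ltW|rewrite mulr_gt0 // subr_gt0].
  have -> : clamp u = 0 by apply/eqP; rewrite eq_le cn c0.
  by rewrite subr0 mul1r mul0r addr0 subr_gt0.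
have := H (- b) (- s) (- t); rewrite !ltrN2 => /(_ sb tb) Hb.
rewrite H //= -ltrN2.
by have -> : - (s + clamp u * (t - s)) = - s + clamp u * (- t - - s) by ring.
Qed.

Lemma segment_path_dist s t u : `|s - segment_path s t u| <= `|s - t|.
Proof.
rewrite /segment_path opprD addrA subrr sub0r normrN normrM distrC.
have /andP[c0 c1] := clamp_itv u.
by rewrite ger0_norm // ler_piMl.
Qed.

Lemma same_cell_dist (N : nat) (s t : R) : (0 < N)%N -> 0 <= s -> 0 <= t ->
  Num.truncn (s * N%:R) = Num.truncn (t * N%:R) -> `|s - t| < N%:R^-1.
Proof.
move=> N0 s0 t0 e; have N0' : 0 < N%:R :> R by rewrite ltr0n.
have /andP[a1 a2] : _ := @truncn_itv R (s * N%:R) ltac:(by rewrite mulr_ge0 // ltW).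
have /andP[b1 b2] : _ := @truncn_itv R (t * N%:R) ltac:(by rewrite mulr_ge0 // ltW).
rewrite -(ltr_pM2r N0') mulVf ?gt_eqF // -[X in _ * X](gtr0_norm N0') -normrM mulrBl.
rewrite -natr1 e in a2; rewrite e in a1; rewrite -natr1 in b2.
by rewrite ltr_norml; apply/andP; split; lra.
Qed.

End Segment.

Lemma equi_uniform (R : realType) (X : pseudoMetricType R) (J : finType) (c : J -> R -> X) (r : R) :
  0 < r -> (forall j, continuous (c j)) -> (forall j t, c j (clamp t) = c j t) ->
  exists2 N, (0 < N)%N & forall j s t, `|s - t| < N%:R^-1 -> ball (c j s) r (c j t).
Proof.
move=> r0 cc ccl.
have /choice[M HM] : forall j, exists M : nat, forall s t,
    `|s - t| < M.+1%:R^-1 -> ball (c j s) r (c j t).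
  move=> j; have [d d0 Hd] := path_unif (cc j) (ccl j) r0.
  exists (Num.bound d^-1) => s t st; apply: Hd; apply: lt_le_trans st _.
  rewrite invf_ple ?posrE ?ltr0n //; apply/ltW; apply: lt_trans (_ : (Num.bound d^-1)%:R < _).
    by rewrite archi_boundP // invr_ge0 ltW.
  by rewrite ltr_nat.
exists (\max_j M j).+1 => // j s t st; apply: HM; apply: lt_le_trans st _.
rewrite lef_pV2 ?posrE ?ltr0n // ler_nat ltnS; exact: leq_bigmax.
Qed.

Section Join.
Variables (R : realType) (f : S2 R -> S2 R) (A C : set (S2 R)).
Hypothesis mf : marked_pcf f A.
Hypothesis sC : simple_closed_curve C.
Hypothesis AC : A `&` C = set0.

Lemma uniform_chart : exists2 r : R, 0 < r & forall x (a b : R -> S2 R), C x ->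
  continuous a -> continuous b ->
  (forall t, a (clamp t) = a t) -> (forall t, b (clamp t) = b t) ->
  (forall t, ball x r (a t)) -> (forall t, ball x r (b t)) -> a 0 = b 0 -> a 1 = b 1 ->
  path_homotopic A a b.
Proof.
have cC : compact C.
  have [c [cc _ <-]] := sC; apply: continuous_compact; first exact: continuous_subspaceT.
  exact: compact_sphere.
suff [r r0 rP] : exists2 r : R, 0 < r & forall x, C x -> forall a b : R -> S2 R,
    continuous a -> continuous b ->
    (forall t, a (clamp t) = a t) -> (forall t, b (clamp t) = b t) ->
    (forall t, ball x r (a t)) -> (forall t, ball x r (b t)) -> a 0 = b 0 -> a 1 = b 1 ->
    path_homotopic A a b by exists r => // x a b /rP; exact.
apply: compact_uniform => // x Cx.
have Ax : ~ A x by move=> Ax; rewrite -[False]/((set0 : set (S2 R)) x) -AC.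
have [W /nbhs_ballP[d /= d0 dW] HW] := marked_chart mf Ax.
exists (d / 2); first by rewrite divr_gt0.
move=> x' r xx' /andP[r0 rd] a b ca cb ac bc xa xb; apply: HW => // t.
  by apply: dW; apply: (@ball_split _ _ x') => //; apply: le_ball (xa t); exact: ltW.
by apply: dW; apply: (@ball_split _ _ x') => //; apply: le_ball (xb t); exact: ltW.
Qed.

Variables (V G : set (S2 R)) (m : nat) (e : 'I_m -> R -> S2 R).
Hypothesis ce : forall i, continuous (e i).
Hypothesis ec : forall i t, e i (clamp t) = e i t.
Hypothesis einj : forall i s t, 0 < s < 1 -> 0 < t < 1 -> e i s = e i t -> s = t.
Hypothesis edisj : forall i j s t, 0 < s < 1 -> 0 < t < 1 -> e i s = e j t -> i = j.

(** A cell fixes a short parameter interval on an edge and another on one half of [C]. Two points of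
    the same piece in one cell are joined by a short arc of each kind, and both arcs lie in a ball
    in which such paths are homotopic off [A]. *)
Lemma piece_curve_cells : exists (B : finType) (cell : S2 R -> B),
  forall p x y, piece f V G e p -> p x -> p y -> C x -> C y -> cell x = cell y ->
  exists a b : R -> S2 R, [/\ continuous a /\ continuous b,
    (forall t, a (clamp t) = a t) /\ (forall t, b (clamp t) = b t),
    (forall t, p (a t)) /\ (forall t, C (b t)), [/\ a 0 = x, b 0 = x & a 1 = y] &
    path_homotopic A a b].
Proof.
have [r r0 Hr] := uniform_chart.
have [h [ch hc hC]] := simple_closed_curve_cover sC.
have [N1 N10 H1] := equi_uniform r0 ce ec.
have [N2 N20 H2] := equi_uniform r0 ch hc.
have /choice[pe Hpe] : forall x, exists o : option ('I_m * R),
    if o is Some (i, t) then 0 < t < 1 /\ e i t = x else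
      forall i t, 0 < t < 1 -> e i t <> x.
  move=> x; have [[[i t] H]|nx] := pselect (exists q : 'I_m * R, 0 < q.2 < 1 /\ e q.1 q.2 = x).
    by exists (Some (i, t)).
  by exists None => i t t01 et; apply: nx; exists (i, t).
have /choice[ph Hph] : forall x, exists q : bool * R, C x -> 0 <= q.2 <= 1 /\ h q.1 q.2 = x.
  move=> x; have [/hC[b [t ht]]|nx] := pselect (C x); last by exists (true, 0).
  by exists (b, clamp t) => _; rewrite clamp_itv hc.
(* There is one index more than [N1] or [N2] because the parameter 1 truncates to the number of
   intervals itself. Vertices have no edge parameter, whence the option. *)
pose cell x : option ('I_m * 'I_N1.+1) * (bool * 'I_N2.+1) :=
  (omap (fun q => (q.1, inord (Num.truncn (q.2 * N1%:R)))) (pe x),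
   ((ph x).1, inord (Num.truncn ((ph x).2 * N2%:R)))).
have trunc_inj (N : nat) (s t : R) : (0 < N)%N -> 0 <= s <= 1 -> 0 <= t <= 1 ->
    inord (Num.truncn (s * N%:R)) = inord (Num.truncn (t * N%:R)) :> 'I_N.+1 -> `|s - t| < N%:R^-1.
  move=> N0 /andP[s0 s1] /andP[t0 t1] /(f_equal val).
  rewrite /= !inordK; first exact: same_cell_dist.
    by rewrite ltnS -(ler_nat R) (le_trans (_ : _ <= t * N%:R)) ?truncn_le ?mulr_ge0 // ler_piMl.
  by rewrite ltnS -(ler_nat R) (le_trans (_ : _ <= s * N%:R)) ?truncn_le ?mulr_ge0 // ler_piMl.
exists _, cell => p x y pp px py Cx Cy [cellE cellb cellH].
have nA z : C z -> ~ A z by move=> Cz Az; rewrite -[False]/((set0 : set (S2 R)) z) -AC.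
case: pp => [[v Mv pE]|[i [a [b [ap pE]]]]].
  move: px py; rewrite pE => /= xv yv; exists (fun=> v), (fun=> v); split => //.
  - by split=> ?; exact: cvg_cst.
  - by split => // _; rewrite -xv.
  - exists (fun _ _ => v); split => //; first by move=> ?; exact: cvg_cst.
    by move=> _ _; apply: nA; rewrite -xv.
move: px py; rewrite pE => -[s sab xs] -[t tab yt].
move: sab tab; rewrite /= !in_itv /= => sab tab.
have s01 := arc_piece_param ap sab; have t01 := arc_piece_param ap tab.
have pe_of z w : 0 < w < 1 -> e i w = z -> pe z = Some (i, w).
  move=> w01 ew; have := Hpe z; case: (pe z) => [[j u] [u01 eu]|/(_ i w w01)//].
  have ij := edisj u01 w01 (etrans eu (esym ew)); subst j.
  by rewrite (einj u01 w01 (etrans eu (esym ew))).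
move: cellE; rewrite (pe_of _ _ s01 xs) (pe_of _ _ t01 yt) /= => -[cellE].
have st : `|s - t| < N1%:R^-1.
  by apply: trunc_inj cellE => //; [move: s01|move: t01] => /andP[/ltW-> /ltW->].
have [u01 hu] := Hph x Cx; have [w01 hw] := Hph y Cy.
have uw : `|(ph x).2 - (ph y).2| < N2%:R^-1 by exact: trunc_inj cellH.
rewrite cellb in hu.
set k := (ph y).1 in hu hw; set u := (ph x).2 in u01 hu uw; set w := (ph y).2 in w01 hw uw.
pose al := e i \o segment_path s t; pose be := h k \o segment_path u w.
have cal : continuous al.
  by move=> z; apply: continuous_comp; [exact: segment_path_continuous|exact: ce].
have cbe : continuous be.
  by move=> z; apply: continuous_comp; [exact: segment_path_continuous|exact: ch].
have a0 : al 0 = x by rewrite /al /= segment_path0.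
have b0 : be 0 = x by rewrite /be /= segment_path0.
have a1 : al 1 = y by rewrite /al /= segment_path1.
have b1 : be 1 = y by rewrite /be /= segment_path1.
have ac z : al (clamp z) = al z by rewrite /al /= segment_path_clamp.
have bc z : be (clamp z) = be z by rewrite /be /= segment_path_clamp.
exists al, be; split => //.
- split=> z; last by apply/hC; exists k, (segment_path u w z).
  by exists (segment_path s t z) => //=; rewrite in_itv /=; exact: segment_path_itv.
- apply: (Hr x) => //.
  + by move=> z; rewrite -xs; apply: H1; apply: le_lt_trans st; exact: segment_path_dist.
  + by move=> z; rewrite -hu; apply: H2; apply: le_lt_trans uw; exact: segment_path_dist.
  + by rewrite a0.
  + by rewrite a1.
Qed.

End Join.

Section GrowthBound.
Variables (R : realType) (f : S2 R -> S2 R) (A V G C : set (S2 R)) (m : nat)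
  (e : 'I_m -> R -> S2 R).
Hypothesis mf : marked_pcf f A.
Hypothesis finV : finite_set V.
Hypothesis fV : forall x, V x -> V (f x).
Hypothesis fG : forall x, G x -> G (f x).
Hypothesis ce : forall i, continuous (e i).
Hypothesis ec : forall i t, e i (clamp t) = e i t.
Hypothesis e0 : forall i, V (e i 0).
Hypothesis e1 : forall i, V (e i 1).
Hypothesis einj : forall i s t, 0 < s < 1 -> 0 < t < 1 -> e i s = e i t -> s = t.
Hypothesis eint : forall i t, 0 < t < 1 -> ~ V (e i t).
Hypothesis edisj : forall i j s t, 0 < s < 1 -> 0 < t < 1 -> e i s = e j t -> i = j.
Hypothesis GE : forall x, G x <-> V x \/ exists i t, 0 < t < 1 /\ e i t = x.
Hypothesis mk : forall I, is_component (G `\` f @^-1` V) I ->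
    (exists c, forall x, I x -> f x = c) \/ homeo_between I (f @` I) f.
Hypothesis h0 : h_top f G = 0%E.
Hypothesis sC : simple_closed_curve C.
Hypothesis AC : A `&` C = set0.

Let hX := @hausdorff_sphere R 2.
Let cX := @compact_sphere R 2.
Let cf := marked_continuous mf.
Let P := piece f V G e.

(* Two points of [G] on level-[k] preimages of [C] with the same itinerary and
   nearby images: the arc of [G] and the arc of [C] joining the images are
   homotopic off [A], so their lifts from the first point both end at the second. *)
Lemma same_descendant (T : finType) (pc : T -> set (S2 R)) k w x y
    (a0 b0 : R -> S2 R) D :
  (forall u, P (pc u)) -> walk (transition f pc) k w ->
  (forall l, (l <= k)%N -> pc (w l) (iter l f x)) ->
  (forall l, (l <= k)%N -> pc (w l) (iter l f y)) ->
  continuous a0 -> continuous b0 ->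
  (forall t, b0 (clamp t) = b0 t) ->
  (forall t, pc (w k) (a0 t)) -> (forall t, C (b0 t)) ->
  a0 0 = iter k f x -> b0 0 = iter k f x -> a0 1 = iter k f y ->
  path_homotopic A a0 b0 -> descendant f C k D -> D x -> D y.
Proof.
move=> Ppc W wx wy ca cb bc pa Cb ax bx ay hab CD Dx.
have /choice[inv Hinv] : forall u, exists g : S2 R -> S2 R,
    {within f @` pc u, continuous g} /\ forall x, pc u x -> g (f x) = x.
  by move=> u; have [g ? ?] := piece_inverse (marked_fiber mf) ce einj GE mk (Ppc u); exists g.
(* Lifting by inverse branches along the common itinerary carries the second end to
   [iter (k - l) f y]. *)
pose al := fix al l := if l is l'.+1 then inv (w (k - l)%N) \o al l' else a0.
have Hal l : (l <= k)%N -> [/\ continuous (al l), forall t, pc (w (k - l)%N) (al l t),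
    al l 0 = iter (k - l) f x, al l 1 = iter (k - l) f y &
    (0 < l)%N -> forall t, f (al l t) = al l.-1 t].
  elim: l => [|l IH] lk; first by rewrite subn0; split.
  have [cl pl l0 l1 _] := IH (ltnW lk).
  have kl : (k - l = (k - l.+1).+1)%N by lia.
  have kl1 : (k - l.+1 < k)%N by lia.
  have /asboolP sub := W _ kl1; rewrite -kl in sub.
  have [cg gK] := Hinv (w (k - l.+1)%N).
  have key z : pc (w (k - l)%N) z -> f (inv (w (k - l.+1)%N) z) = z /\
      pc (w (k - l.+1)%N) (inv (w (k - l.+1)%N) z).
    by move=> /sub[z' pz' <-]; rewrite gK.
  split.
  - apply: (within_comp_continuous cg cl) => t; exact: sub.
  - by move=> t; exact: (key _ (pl t)).2.
  - by rewrite /= l0 kl iterS gK //; apply: wx; exact: ltnW.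
  - by rewrite /= l1 kl iterS gK //; apply: wy; exact: ltnW.
  - by move=> _ t /=; exact: (key _ (pl t)).1.
have /choice[lft Hlft] : forall q : (R -> S2 R) * S2 R, exists g : R -> S2 R,
    continuous q.1 -> (forall t, q.1 (clamp t) = q.1 t) -> (forall t, ~ A (q.1 t)) ->
    f q.2 = q.1 0 -> [/\ continuous g, forall t, g (clamp t) = g t, g 0 = q.2 &
    forall t, f (g t) = q.1 t].
  move=> [p z] /=.
  have [H|nH] := pselect [/\ continuous p, forall t, p (clamp t) = p t,
      forall t, ~ A (p t) & f z = p 0].
    have [cp pc' pA pz] := H.
    by have [g ?] := lift_exists hX cX cf (marked_section mf) cp pc' pA pz; exists g.
  by exists (fun=> z) => cp pc' pA pz; case: nH.
(* The arc of [C] is lifted from the orbit of [x]; the last lift stays over [C], hence inside [D],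
   and only its end has to be identified with [y]. *)
pose be := fix be l := if l is l'.+1 then lft (be l', iter (k - l) f x) else b0.
have Hbe l : (l <= k)%N -> [/\ continuous (be l), forall t, be l (clamp t) = be l t,
    forall t, ~ A (be l t) /\ iter l f (be l t) = b0 t, be l 0 = iter (k - l) f x &
    (0 < l)%N -> forall t, f (be l t) = be l.-1 t].
  elim: l => [|l IH] lk.
    rewrite subn0; split => // t; split => // Ab.
    by rewrite -[False]/((set0 : set (S2 R)) (b0 t)) -AC.
  have [cl cll lA l0 _] := IH (ltnW lk).
  have kl : (k - l = (k - l.+1).+1)%N by lia.
  have [||||cg gc g0 gf] := Hlft (be l, iter (k - l.+1) f x) => //.
  - by move=> t; exact: (lA t).1.
  - by rewrite /= l0 kl.
  split => // t; have [nA it] := lA t; split.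
    by move=> /(marked_sub mf) /=; rewrite gf.
  by rewrite iterSr gf.
have : al k 1 = be k 1.
  apply: (iter_lift_end hX cX cf (marked_section mf) (marked_sub mf)) => //.
  - by move=> i ik; have [? _ _ _ _] := Hal i ik; have [? _ _ _ _] := Hbe i ik.
  - move=> i t ik; have [_ _ _ _ /(_ isT t) ?] := Hal i.+1 ik.
    by have [_ _ _ _ /(_ isT t) ?] := Hbe i.+1 ik.
  - move=> i ik; have [_ _ -> _ _] := Hal i ik.
    by have [_ _ _ -> _] := Hbe i ik.
have [_ _ _ -> _] := Hal k (leqnn k); rewrite subnn /= => ->.
have [cbk _ bA b00 _] := Hbe k (leqnn k); rewrite subnn /= in b00.
apply: (descendant_path (R := R) cf CD cbk); first by rewrite b00.
by move=> t; rewrite (bA t).2.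
Qed.

Lemma descendant_growth_bound : exists c d, forall k (I : finType) (F : I -> set (S2 R)),
  injective F -> (forall i, descendant f C k (F i)) -> (forall i, F i `&` G !=set0) ->
  (#|I| <= c * k.+1 ^ d)%N.
Proof.
have [[z0 Gz0]|nG] := pselect (G !=set0); last first.
  exists 0%N, 0%N => k I F _ _ FG; rewrite mul0n leqn0; apply/eqP/eq_card0 => i.
  by case: nG; have [x [_ Gx]] := FG i; exists x.
have finP := finite_pieces G (marked_fiber mf) finV einj.
have /finite_seqP[s sE] : finite_set P by exact: finP.
pose T : finType := seq_sub s; pose pc (u : T) : set (S2 R) := ssval u.
have Ppc u : P (pc u).
  by rewrite sE; exact: (valP u).
have cover x : G x -> exists u : T, pc u x.
  move=> Gx; have [p Pp px] := piece_cover (marked_fiber mf) finV fV e0 e1 einj GE Gx.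
  have ps : p \in s by have := Pp; rewrite -/P sE.
  by exists (SeqSub ps).
have [u0 _] := cover _ Gz0.
have /choice[sym Hsym] : forall x, exists u : T, G x -> pc u x.
  move=> x; have [/cover[u ?]|nGx] := pselect (G x); last by exists u0.
  by exists u.
have pc_inj u v x : pc u x -> pc v x -> u = v.
  move=> ux vx; apply: val_inj.
  exact: (piece_disjoint einj edisj (Ppc u) (Ppc v) ux vx).
have unique := @closed_walk_unique R f G T pc
  (fun u => piece_sub GE (Ppc u)) pc_inj _ _ _ _ h0.
have {}unique n w w' : walk (transition f pc) n w -> walk (transition f pc) n w' ->
    w 0%N = w n -> w' 0%N = w' n -> w 0%N = w' 0%N -> forall i, (i <= n)%N -> w i = w' i.
  apply: unique.
  - move=> u; have [[v _ ->]|[i [a [b [[_ ab _ _ _] ->]]]]] := Ppc u; first by exists v.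
    exists (e i ((a + b) / 2)), ((a + b) / 2) => //=.
    by rewrite in_itv /=; apply/andP; split; lra.
  - by move=> u; exact: (piece_connected ce (Ppc u)).
  - by move=> u; exact: (piece_inverse (marked_fiber mf) ce einj GE mk (Ppc u)).
  - by move=> J Z u J5; exact: (piece_separation hX ce e0 e1 einj eint J5 (Ppc u)).
have [B [cell Hcell]] := piece_curve_cells mf sC AC V G ce ec einj edisj.
have iG k x : G x -> G (iter k f x) by elim: k => //= k IH /IH /fG.
pose itin x l := sym (iter l f x).
have itinP x l : G x -> pc (itin x l) (iter l f x) by move=> Gx; exact/Hsym/iG.
have itin_walk k x : G x -> walk (transition f pc) k (itin x).
  move=> Gx l _; apply/asboolP.
  have qx := itinP x l.+1 Gx; rewrite /= in qx.
  exact: (piece_markov hX cf (marked_fiber mf) fG ce e0 e1 einj eint edisj GE mk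
    (Ppc (itin x l)) (Ppc (itin x l.+1)) (itinP x l Gx) qx).
pose t := #|T|.
(* The constants are those of [card_walk_code], with the number of cells as an extra factor. *)
exists (t * t ^ t * #|B|)%N, t => k I F Finj CF FG.
have /choice[x Hx] : forall i, exists x, F i x /\ G x by move=> i; have [x ?] := FG i; exists x.
pose code i := (walk_code k (itin (x i)), cell (iter k f (x i))).
have code_inj : injective code.
  move=> i i' ecode; apply: Finj.
  have [Fx Gx] := Hx i; have [Fx' Gx'] := Hx i'.
  have agree := walk_code_inj unique (itin_walk k _ Gx) (itin_walk k _ Gx') (f_equal fst ecode).
  have Cx := descendant_iter (CF i) Fx; have Cx' := descendant_iter (CF i') Fx'.
  have py : pc (itin (x i) k) (iter k f (x i')) by rewrite agree //; exact: itinP.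
  have [a [b [[ca cb] [ac bc] [pa Cb] [a0 b0 a1] hab]]] :=
    Hcell _ _ _ (Ppc (itin (x i) k)) (itinP _ k Gx) py Cx Cx' (f_equal snd ecode).
  have Fy : F i (x i').
    apply: (same_descendant (w := itin (x i)) (x := x i) (y := x i') Ppc
      (itin_walk k _ Gx) _ _ ca cb bc pa Cb a0 b0 a1 hab (CF i) Fx).
    - by move=> l _; exact: itinP.
    - by move=> l lk; rewrite agree //; exact: itinP.
  by have [] := descendant_eq (fun z _ _ => erefl C) (CF i) (CF i') Fy Fx'.
apply: leq_trans (leq_card _ code_inj) _.
rewrite card_prod card_walk_code -/t expnMn.
by rewrite [X in (t * X)%N]mulnC mulnA mulnAC.
Qed.

End GrowthBound.

Unset Implicit Arguments.

Theorem theorem7p6 (R : realType) (f : S2 R -> S2 R) (A V G : set (S2 R))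
    (n : nat) (gam : 'I_n -> set (S2 R)) :
  marked_pcf f A ->
  embedded_graph V G ->
  f @` G `<=` G ->
  markov_graph_map f V G ->
  h_top f G = 0%E ->
  thurston_obstruction f A gam ->
  irreducible_multicurve f A gam ->
  intersects A gam G ->
  levy_cycle f A gam.
Proof.
move=> mf [finV [m [e [ce eV einj [eint edisj] GE]]]] fG [fV mk] h0 [mg rad] irr [i0 meets].
apply: (levy_of_unique_components mf mg irr i0 rad) => j C' C'' i i' cC' cC'' iC' iC''.
apply: contrapT => C'C''.
have c01 t : 0 < t < 1 -> clamp t = t by move=> /andP[/ltW t0 /ltW t1]; rewrite clamp_id ?t0.
(* The given edges are controlled on [0, 1] only; clamping makes them continuous on the line without
   changing interior parameters. *)
pose e' k := e k \o @clamp R.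
have e'E k t : 0 < t < 1 -> e' k t = e k t by move=> t01; rewrite /e' /= c01.
have [sC AC _ _] := mg.1 j.
have [||||||||||c [d bound]] := @descendant_growth_bound R f A V G (gam j) m e'
  mf finV _ _ _ _ _ _ _ _ _ _ mk h0 sC AC.
- by move=> x Vx; apply: fV; exists x.
- by move=> x Gx; apply: fG; exists x.
- move=> k; apply: (within_comp_continuous (ce k)); first exact: continuous_clamp.
  by move=> t; rewrite /= in_itv /= clamp_itv.
- by move=> k t; rewrite /e' /= clampK.
- by move=> k; rewrite /e' /= clamp0; case: (eV k).
- by move=> k; rewrite /e' /= clamp1; case: (eV k).
- by move=> k s t s01 t01; rewrite !e'E //; exact: einj.
- move=> k t t01 Vt; rewrite -[False]/((set0 : set (S2 R)) (e' k t)) -(eint k); split => //.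
  by exists t; rewrite ?e'E //= in_itv.
- move=> k l s t s01 t01 est; apply/eqP; apply: contrapT => /negP kl.
  rewrite -[False]/((set0 : set (S2 R)) (e' k s)) -(edisj _ _ kl); split.
    by exists s; rewrite ?e'E //= in_itv.
  by rewrite est; exists t; rewrite ?e'E //= in_itv.
- move=> x; rewrite GE; split => [[Vx|[k _ [t /=]]]|[Vx|[k [t [t01 <-]]]]]; [by left| |by left|].
    rewrite in_itv /= => /andP[]; rewrite le_eqVlt => /predU1P[<- _ <-|t0].
      by left; case: (eV k).
    rewrite le_eqVlt => /predU1P[-> <-|t1 <-]; first by left; case: (eV k).
    by right; exists k, t; rewrite e'E t0.
  right; exists k => //; exists t; rewrite ?e'E //= in_itv /=.
  by case/andP: t01 => /ltW-> /ltW->.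
have [a [b grow]] := branching_growth mf mg irr i0 cC' cC'' C'C'' iC' iC''.
(* [b.+1] because the bound at level [k = q * a + b] involves [k.+1]. *)
have [q] := exp2_beats_poly a b.+1 c d.
rewrite ltnNge => /negP; apply.
have [F [Finj HF]] := grow q.
have := bound (q * a + b)%N _ F Finj (fun s => (HF s).1).
rewrite card_tuple card_bool -addnS [(q * a)%N]mulnC; apply=> s.
by apply: meets; apply: isotopic_sym; exact: (HF s).2.
Qed.
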